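(* Let $(X,\mathsf d)$ be a complete and separable metric space, $\mathfrak m\in\mathcal M_+(X)$ a finite Borel measure, $p\in(1,\infty)$ and $q=p/(p-1)$. Let $f:X\to\mathbb R$ be a Borel function and set $$\Gamma=\bigl\{\gamma\in AC^\infty([0,1];X):\ f\circ\gamma\ \text{has a continuous representative } f_\gamma:[0,1]\to\mathbb R\bigr\}.$$ If $\mathrm{Mod}_{p,\mathfrak m}\bigl(M(AC^\infty([0,1];X)\setminus\Gamma)\bigr)=0$, then there exists an $\mathfrak m$-measurable representative $\tilde f:X\to\mathbb R$ of $f$ (i.e. $\mathfrak m(\{f\ne\tilde f\})=0$) satisfying $$\mathrm{Mod}_{p,\mathfrak m}\bigl(M(\{\gamma\in\Gamma:\ \tilde f\circ\gamma\not\equiv f_\gamma\})\bigr)=0.$$ In particular: (i) for $q$-a.e. curve $\gamma$ there holds $\tilde f\circ\gamma\equiv f_\gamma$; (ii) for $\mathrm{Mod}_{p,\mathfrak m}$-a.e. curve $\underline\gamma\in\mathscr C(X)$ there holds $\tilde f\circ\mathsf j\underline\gamma\equiv f_{\mathsf j\underline\gamma}$.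
   Context: $\mathcal M_+(X)$ is the set of finite nonnegative Borel measures on $X$. $AC([0,1];X)$ is the set of absolutely continuous curves $\gamma:[0,1]\to X$, with metric derivative $|\dot\gamma|$ and length $\ell(\gamma)=\int_0^1|\dot\gamma_t|\,dt$; $AC^q([0,1];X)$ is the subset with $|\dot\gamma|\in L^q(0,1)$; $AC^\infty([0,1];X)$ is the set of Lipschitz curves (constant curves included). $C([0,1];X)$ carries the uniform topology. A continuous representative $f_\gamma$ of $f\circ\gamma$ (for $\gamma\in AC([0,1];X)$) is a continuous function $f_\gamma:[0,1]\to\mathbb R$ equal to $f\circ\gamma$ $\mathscr L^1$-a.e. in $(0,1)$; ''$\equiv$'' means equality at every $t\in[0,1]$. In (i) and (ii) the assertion includes that the continuous representative exists for almost every curve in the stated sense. $M\gamma=\gamma_\sharp(\mathscr L^1\llcorner[0,1])$ and $J\gamma=\gamma_\sharp(|\dot\gamma|\mathscr L^1\llcorner[0,1])$. With $\mathcal L^p_+(X,\mathfrak m)$ the set of Borel $f:X\to[0,\infty]$ with $\int_X f^p\,d\mathfrak m<\infty$, for $\Sigma\subset\mathcal M_+(X)$ set $\mathrm{Mod}_{p,\mathfrak m}(\Sigma)=\inf\{\int_X f^p\,d\mathfrak m: f\in\mathcal L^p_+(X,\mathfrak m),\ \int_X f\,d\mu\ge1\ \forall\mu\in\Sigma\}$ ($\inf\emptyset=\infty$). Non-parametric curves: $\gamma\sim\tilde\gamma$ if $\gamma=\tilde\gamma\circ\varphi$ with $\varphi$ an increasing bijection of $[0,1]$, $\varphi,\varphi^{-1}$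 absolutely continuous. $\mathscr C(X)$ is the quotient by $\sim$ of $\{\gamma\in AC([0,1];X):|\dot\gamma|>0\text{ a.e.}\}$; $\mathsf j\underline\gamma$ is the unique representative of $\underline\gamma\in\mathscr C(X)$ with constant speed ($|\dot\gamma|=\ell(\gamma)>0$ a.e.). A property holds for $\mathrm{Mod}_{p,\mathfrak m}$-a.e. $\underline\gamma\in\mathscr C(X)$ if $\mathrm{Mod}_{p,\mathfrak m}(\{J\mathsf j\underline\gamma:\text{the property fails at }\underline\gamma\})=0$. $q$-a.e.: with $\mathrm e_t(\gamma)=\gamma_t$, a Borel probability measure $\boldsymbol\rho$ on $C([0,1];X)$ is a $q$-test plan if it is concentrated on $AC^q([0,1];X)$ and $(\mathrm e_t)_\sharp\boldsymbol\rho\le C\mathfrak m$ for all $t\in[0,1]$, for some constant $C>0$. A universally measurable set of curves is $q$-negligible if it is $\boldsymbol\rho$-null for all $q$-test plans $\boldsymbol\rho$; a property holds for $q$-a.e. curve if it fails only on a subset of a $q$-negligible set (in particular $C([0,1];X)\setminus AC^q([0,1];X)$ is $q$-negligible). *)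

(* Defs.v *)
From HB Require Import structures.
From mathcomp Require Import all_boot all_order all_algebra.
From mathcomp Require Import all_classical all_reals all_analysis.
From mathcomp Require Import measurable_realfun lra.

Set Implicit Arguments.
Unset Strict Implicit.
Unset Printing Implicit Defensive.

Import Order.TTheory GRing.Theory Num.Theory.
Import numFieldNormedType.Exports.

Local Open Scope classical_set_scope.
Local Open Scope ring_scope.

#[short(type="completeMetricType")]
HB.structure Definition CompleteMetric (R : realType) :=
  {T of Complete T & Metric R T}.

Definition separable (T : topologicalType) :=
  exists2 S : set T, countable S & dense S.

Notation borel T := (g_sigma_algebraType (@open T)).

Section completion.
Context d (T : measurableType d) (R : realType).

Definition completion_measurable (mu : set T -> \bar R) (A : set T) :=
  exists2 B, measurable B & mu.-negligible (A `+` B).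

Definition completion_measurable_fun d' (U : measurableType d')
    (mu : set T -> \bar R) (f : T -> U) :=
  forall B, measurable B -> completion_measurable mu (f @^-1` B).

Definition universally_measurable (A : set T) :=
  forall mu : {finite_measure set T -> \bar R}, completion_measurable mu A.

End completion.

Section unit_interval.
Variable R : realType.

Definition I01 : set R := `[0, 1]%classic.

Lemma measurable_I01 : measurable I01.
Proof. exact: measurable_itv. Qed.

Lemma clip_subproof (t : R) : Num.max 0 (Num.min 1 t) \in I01.
Proof.
rewrite inE /I01/= in_itv/= le_max lexx/=.
by rewrite ge_max ler01 ge_min lexx.
Qed.

(* The retraction of R onto [0,1]: a curve g : [0,1] -> X is read at a real
   time t as g (clip t), so that one can use the Lebesgue measure of R. *)
Definition clip (t : R) : I01 := SigSub (clip_subproof t).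

Lemma clip_continuous : continuous clip.
Proof.
apply: (@continuous_comp_initial _ _ _ (set_val : I01 -> R)).
rewrite (_ : _ \o _ = (fun t => Num.max 0 (Num.min 1 t))); last exact/funext.
move=> t; apply: continuous_max; first exact: cvg_cst.
by apply: continuous_min; [exact: cvg_cst|exact: cvg_id].
Qed.

Definition leb01 : set (measurableTypeR R) -> \bar R :=
  mrestr (@lebesgue_measure R) measurable_I01.

HB.instance Definition _ := Measure.on leb01.

Let leb01_fin : fin_num_fun leb01.
Proof.
apply: lty_fin_num_fun; rewrite /= /leb01 /mrestr setTI.
by rewrite /I01 lebesgue_measure_itv/= lte_fin ltr01 oppr0 adde0 ltry.
Qed.

HB.instance Definition _ := Measure_isFinite.Build _ _ _ leb01 leb01_fin.

End unit_interval.

Arguments I01 : clear implicits.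
Arguments leb01 : clear implicits.

(* C([0,1];T); when T is a complete metric space it carries the topology of
   uniform convergence. *)
Definition C01 (R : realType) (T : topologicalType) :=
  continuousType (I01 R) T.

HB.instance Definition _ (R : realType) (T : topologicalType) :=
  Choice.on (C01 R T).

HB.instance Definition _ (R : realType) (X : completeMetricType R) :=
  Topological.copy (C01 R X)
   (@initial_topology (C01 R X) {uniform I01 R -> X} (fun g => g : _ -> _)).

HB.instance Definition _ (R : realType) (X : completeMetricType R) :=
  isPointed.Build (C01 R X) (cst point : continuousType _ _).

Section curves.
Context (R : realType) (X : completeMetricType R).
Implicit Types (g : C01 R X) (T : metricType R).

Local Notation mu := (@lebesgue_measure R).

(* Almost everywhere in (0,1). *)
Definition ae01 (P : R -> Prop) := \forall t \ae mu, 0 < t < 1 -> P t.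

Definition ext g : measurableTypeR R -> borel X := g \o @clip R.

Lemma ext_continuous g : continuous (ext g : R -> X).
Proof.
move=> t; apply: (@continuous_comp _ _ _ (@clip R)).
  exact: clip_continuous.
exact: cts_fun.
Qed.

Lemma measurable_ext g : measurable_fun [set: measurableTypeR R] (ext g).
Proof.
apply: (@measurability _ _ (measurableTypeR R) (borel X) setT (ext g) (@open X)) => //.
move=> _ [B oB <-]; rewrite setTI.
apply: open_measurable; apply: open_comp => // t _; exact: ext_continuous.
Qed.

Definition abs_cont T (g : I01 R -> T) := exists2 v : R -> R,
  mu.-integrable (I01 R) (EFin \o v) &
  forall s t : I01 R, val s <= val t ->
    ((mdist (g s) (g t))%:E <= \int[mu]_(r in `[val s, val t]) (v r)%:E)%E.

Definition lipschitz_curve g := exists L : R,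
  forall s t : I01 R, mdist (g s) (g t) <= L * `|val s - val t|.

Definition diff_quot g (t h : R) : R := mdist (ext g t) (ext g (t + h)) / `|h|.

(* The metric derivative. Where the limit does not exist, lim returns 0; for an
   absolutely continuous curve this happens on a null set only. The values at the
   endpoints 0 and 1, where ext g is constant on one side, are never used except
   up to null sets. *)
Definition mderiv g (t : R) : R := lim (diff_quot g t h @[h --> 0^']).

Lemma mderiv_ge0 g t : 0 <= mderiv g t.
Proof.
rewrite /mderiv; have [cv|dv] := pselect (cvg (diff_quot g t h @[h --> 0^'])).
  apply: limr_ge => //; apply: nearW => h.
  by rewrite divr_ge0// mdist_ge0.
by rewrite dvgP.
Qed.

Lemma continuous_diff_quot g h : continuous (diff_quot g ^~ h).
Proof.
move=> t; apply: cvgMl.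
have c1 := @ext_continuous g t.
have c2 : ext g (s + h) @[s --> t] --> (ext g (t + h) : X).
  apply: (@continuous_comp _ _ X (fun s => s + h) (ext g)).
    by apply: cvgD; [exact: cvg_id|exact: cvg_cst].
  exact: ext_continuous.
apply/cvgrPdist_lt => e e0; near=> s.
have d1 : mdist (ext g t : X) (ext g s) < e / 2.
  by near: s; apply: metricType_numDomainType.cvgr_dist_lt => //; rewrite divr_gt0.
have d2 : mdist (ext g (t + h) : X) (ext g (s + h)) < e / 2.
  by near: s; apply: metricType_numDomainType.cvgr_dist_lt => //; rewrite divr_gt0.
have := metric_triangle (ext g t : X) (ext g s) (ext g (t + h)).
have := metric_triangle (ext g s : X) (ext g (s + h)) (ext g (t + h)).
have := metric_triangle (ext g s : X) (ext g t) (ext g (s + h)).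
have := metric_triangle (ext g t : X) (ext g (t + h)) (ext g (s + h)).
rewrite (metric_sym (ext g (s + h)) (ext g (t + h))) (metric_sym (ext g s) (ext g t)).
rewrite ltr_norml => *; apply/andP; split; lra.
Unshelve. all: by end_near. Qed.

Let closed_osc g (k n : nat) := [set t | forall u v : R,
  0 < `|u| < n.+1%:R^-1 -> 0 < `|v| < n.+1%:R^-1 ->
  `|diff_quot g t u - diff_quot g t v| <= k.+1%:R^-1].

Let closed_oscP g k n : closed (closed_osc g k n).
Proof.
rewrite (_ : closed_osc g k n = \bigcap_(uv in
    [set uv : R * R | 0 < `|uv.1| < n.+1%:R^-1 /\ 0 < `|uv.2| < n.+1%:R^-1])
    (fun t => `|diff_quot g t uv.1 - diff_quot g t uv.2|) @^-1` [set x : R | x <= k.+1%:R^-1]); last first.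
  apply/seteqP; split=> [t H [u v] /= [u0 v0]|t H u v u0 v0]; first exact: H.
  exact: (H (u, v)).
apply: (@closed_bigI R) => -[u v] _; apply: preimage_closed; last exact: closed_le.
move=> t _; apply: (@cvg_norm _ R^o); apply: cvgB; exact: continuous_diff_quot.
Qed.

Lemma cvg_diff_quotE g : [set t | cvg (diff_quot g t h @[h --> 0^'])] =
  \bigcap_k \bigcup_n closed_osc g k n.
Proof.
apply/seteqP; split=> [t /= /cvg_cauchy ct k _|t Ht].
  have /cauchy_ballP/(_ k.+1%:R^-1) := ct.
  rewrite invr_gt0 ltr0n => /(_ isT) /= [[A B] /= [A0 B0] AB].
  have : \forall h \near 0^', A (diff_quot g t h) /\ B (diff_quot g t h).
    by apply: filterI.
  rewrite near_withinE near_nbhs => /nbhs_ballP[e /= e0 He].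
  have [n ne] : exists n, n.+1%:R^-1 < e.
    by have [n _ /(_ _ (leqnn n))] := near_infty_natSinv_lt (PosNum e0); exists n.
  exists n => // u v /andP[u0 un] /andP[v0 vn].
  have [Au _] : A (diff_quot g t u) /\ B (diff_quot g t u).
    by apply: He; rewrite -?normr_gt0// /ball/= sub0r normrN (lt_trans un).
  have [_ Bv] : A (diff_quot g t v) /\ B (diff_quot g t v).
    by apply: He; rewrite -?normr_gt0// /ball/= sub0r normrN (lt_trans vn).
  by apply/ltW; apply: (AB (_, _)).
apply/cauchy_cvgP; apply/cauchy_ballP => e e0.
have [k ke] : exists k, k.+1%:R^-1 < e.
  by have [n _ /(_ _ (leqnn n))] := near_infty_natSinv_lt (PosNum e0); exists n.
have [n _ Hn] := Ht k I.
have near0 : \forall h \near (0 : R)^', 0 < `|h| < n.+1%:R^-1.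
  apply/nbhs_ballP; exists n.+1%:R^-1 => /=; first by rewrite invr_gt0.
  by move=> h /=; rewrite /ball/= sub0r normrN -normr_gt0 => -> ->.
exists (diff_quot g t @` [set h | 0 < `|h| < n.+1%:R^-1],
        diff_quot g t @` [set h | 0 < `|h| < n.+1%:R^-1]) => /=.
  by split; apply: filterS near0 => h hn; exists h.
move=> [_ _] [/= [u un <-] [v vn <-]].
by apply: le_lt_trans ke; exact: Hn.
Qed.

Lemma measurable_mderiv g : measurable_fun [set: R] (mderiv g).
Proof.
pose C := [set t | cvg (diff_quot g t h @[h --> 0^'])].
have mC : measurable C.
  rewrite /C cvg_diff_quotE; apply: bigcapT_measurable => k.
  apply: bigcupT_measurable => n; apply: closed_measurable; exact: closed_oscP.
apply: (@measurable_fun_cvg _ _ _ _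
  (fun n t => diff_quot g t n.+1%:R^-1 * \1_C t)) => [n|t _].
  apply: measurable_funM; last exact: measurable_indic.
  by apply: continuous_measurable_fun; exact: continuous_diff_quot.
have [cv|dv] := pselect (C t).
  rewrite indicE mem_set//=; under eq_fun do rewrite mulr1.
  apply: (@cvg_comp _ _ _ (fun n : nat => n.+1%:R^-1 : R) (diff_quot g t) _ (0^')).
    move=> A /nbhs_ballP[e /= e0 eA]; have := near_infty_natSinv_lt (PosNum e0).
    apply: filterS => n ne; apply: eA; last by rewrite /= invr_eq0 pnatr_eq0.
    by rewrite /ball/= sub0r normrN gtr0_norm.
  exact: cv.
rewrite indicE memNset//; under eq_fun do rewrite mulr0.
rewrite /mderiv dvgP//; exact: cvg_cst.
Qed.

Definition speed_measure g (A : set (measurableTypeR R)) : \bar R :=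
  (\int[leb01 R]_(t in A) (mderiv g t)%:E)%E.

Let speed0 g : speed_measure g set0 = 0%E.
Proof. exact: integral_set0. Qed.

Let speed_ge0 g A : (0 <= speed_measure g A)%E.
Proof. by apply: integral_ge0 => t _; rewrite lee_fin mderiv_ge0. Qed.

Let speed_sigma_additive g : semi_sigma_additive (speed_measure g).
Proof.
apply: (@semi_sigma_additive_nng_induced _ _ R (leb01 R)
  (fun t => (mderiv g t)%:E)) => [|t].
  by apply/measurable_EFinP; exact: measurable_mderiv.
by rewrite lee_fin mderiv_ge0.
Qed.

HB.instance Definition _ g := isMeasure.Build _ _ _ (speed_measure g)
  (speed0 g) (speed_ge0 g) (@speed_sigma_additive g).


(* A |-> L^1({t in [0,1] | g t in A}) and
   A |-> \int_{t in [0,1], g t in A} |g'|(t) dt. *)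
Definition occupation_measure g : set (borel X) -> \bar R :=
  pushforward (leb01 R) (ext g).

Definition weighted_measure g : set (borel X) -> \bar R :=
  pushforward (speed_measure g) (ext g).

Let pushM (nu : {measure set (measurableTypeR R) -> \bar R}) g :
  {measure set (borel X) -> \bar R} :=
  @measure_function_pushforward__canonical__measure_function_Measure
    _ _ _ _ _ nu _ (measurable_ext g).

HB.instance Definition _ g := isMeasure.Build _ _ _ (occupation_measure g)
  (measure0 (pushM (leb01 R) g)) (measure_ge0 (pushM (leb01 R) g))
  (@measure_semi_sigma_additive _ _ _ (pushM (leb01 R) g)).

HB.instance Definition _ g := isMeasure.Build _ _ _ (weighted_measure g)
  (measure0 (pushM (speed_measure g) g))
  (measure_ge0 (pushM (speed_measure g) g))
  (@measure_semi_sigma_additive _ _ _ (pushM (speed_measure g) g)).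

Definition M g : {measure set (borel X) -> \bar R} := occupation_measure g.

Definition J g : {measure set (borel X) -> \bar R} := weighted_measure g.

Definition curve_length g : \bar R := (\int[mu]_(t in I01 R) (mderiv g t)%:E)%E.

Definition ACq (q : R) g :=
  abs_cont g /\ (\int[mu]_(t in I01 R) (mderiv g t `^ q)%:E < +oo)%E.

(* g' = g \o phi with phi an increasing bijection of [0,1] which is absolutely
   continuous together with its inverse psi. *)
Definition reparam g' g := exists phi psi : I01 R -> I01 R,
  [/\ forall s t, val s < val t -> val (phi s) < val (phi t),
      cancel phi psi /\ cancel psi phi,
      abs_cont (fun t => val (phi t) : R^o),
      abs_cont (fun t => val (psi t) : R^o) &
      forall t, g' t = g (phi t)].

Definition regular_curve g := abs_cont g /\ ae01 (fun t => 0 < mderiv g t).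

(* The quotient set: a non-parametric curve is an equivalence class. *)
Record np_curve := NPCurve {
  np_class : set (C01 R X) ;
  np_classP : exists2 g, regular_curve g &
    np_class = [set g' | regular_curve g' /\ reparam g' g] }.

Definition constant_speed g :=
  [/\ abs_cont g, (0 < curve_length g)%E &
      ae01 (fun t => (mderiv g t)%:E = curve_length g)].

(* The representative of constant speed; the default value of get is irrelevant
   since every class contains exactly one such curve. *)
Definition j (c : np_curve) : C01 R X :=
  get [set g | np_class c g /\ constant_speed g].

Section modulus.
Variables (p : R) (m : {finite_measure set (borel X) -> \bar R}).

Definition Lplus : set (borel X -> \bar R) := [set h |
  [/\ measurable_fun [set: borel X] h, forall x, (0 <= h x)%E &
      (\int[m]_x (h x `^ p) < +oo)%E]].

(* Mod is applied below to sets of finite measures only: M g has mass 1 and J g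
   has mass the length of g, which is finite when g is absolutely continuous. *)
Definition Mod (S : set {measure set (borel X) -> \bar R}) : \bar R :=
  ereal_inf [set (\int[m]_x (h x `^ p))%E | h in
    [set h | Lplus h /\ forall nu, S nu -> (1 <= \int[nu]_x h x)%E]].

Definition Mod_ae (P : np_curve -> Prop) :=
  Mod [set J (j c) | c in [set c | ~ P c]] = 0%E.

Definition test_plan (q : R) (rho : probability (borel (C01 R X)) R) :=
  rho.-negligible (~` [set g | ACq q g]) /\
  exists2 C : R, 0 < C & forall (t : I01 R) (B : set (borel X)), measurable B ->
    (pushforward rho (fun g : borel (C01 R X) => g t : borel X) B <= C%:E * m B)%E.

Definition q_negligible (q : R) (N : set (borel (C01 R X))) :=
  universally_measurable R N /\
  forall rho, test_plan q rho -> rho.-negligible N.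

Definition q_ae (q : R) (P : C01 R X -> Prop) :=
  exists2 N, q_negligible q N & [set g | ~ P g] `<=` N.

End modulus.

Section representatives.
Variable f : X -> R.

(* fg is the continuous representative of f \o g: the continuity of fg is part of
   the type C01 R R, and fg is unique. *)
Definition continuous_rep g (fg : C01 R R) :=
  ae01 (fun t => fg (clip t) = f (g (clip t))).

Definition Gamma : set (C01 R X) :=
  [set g | lipschitz_curve g /\ exists fg, continuous_rep g fg].

(* The continuous representative of f \o g exists and coincides with ft \o g at
   every time. *)
Definition equals_rep (ft : X -> R) g :=
  exists2 fg, continuous_rep g fg & forall t, ft (g t) = fg t.

End representatives.

End curves.

(* Main.v *)
(* By Fuglede's lemma there is h in L^p_+ whose integral against M g is infinite
   for every Lipschitz curve g outside Gamma.  Put ft x := f_g(t) if some Lipschitz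
   curve g with finite integral of h along M g visits x at time t, and ft x := f x
   otherwise.  The value does not depend on g: from two such curves visiting x one
   glues unit-speed pieces of duration 1/2 into a single Lipschitz curve through x
   along which h is still integrable, and its continuous representative restricts
   to both.  Constant curves give ft = f wherever h is finite, and the integral of h
   is infinite along every curve on which ft and f_g differ.
   For a test plan, Young's inequality bounds the integral of h(g_t)|g'|(t) by those
   of h^p and |g'|^q, so almost every curve becomes, after reparametrization by the
   primitive of a multiple of 1 + |g'|, a Lipschitz curve with finite integral of h.
   For a constant-speed curve J g is a multiple of M g. *)
Require Import Defs.
From HB Require Import structures.
From mathcomp Require Import all_boot all_order all_algebra.
From mathcomp Require Import all_classical all_reals all_analysis.
From mathcomp Require Import measurable_realfun ring lra.

Import Order.TTheory GRing.Theory Num.Theory.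
Import numFieldNormedType.Exports.

Local Open Scope classical_set_scope.
Local Open Scope ring_scope.

Set Implicit Arguments.
Unset Strict Implicit.
Unset Printing Implicit Defensive.

(** * The modulus and Fuglede's lemma *)

(** The definitions leave two existence questions open. [mderiv] is a [lim] that falls back to 0, so
    one has to prove that the metric derivative of an absolutely continuous curve exists almost
    everywhere; this is done for an abstract pseudo-distance on the line dominated by the increments
    of a primitive. The function [j] is a choice by [get], so every class has to be shown to contain
    a curve of constant speed, with both changes of time absolutely continuous. In the gluing, unit
    speed keeps the integral of [h] over a piece below the integral along the whole curve. For test
    plans, the summand 1 in 1 + |g'| makes the change of time a homeomorphism even if the curve
    rests. There the obstacle is that the exceptional set must be universally measurable: absolute
    continuity is replaced by countably many inequalities at rational times, and |g'| by a limit
    superior that is jointly measurable in curve and time. The construction of [ft] gives no Borel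
    measurability: its measurability rests on its equality with [f] off the negligible set where [h]
    is infinite. *)

Section modulus.
Context (R : realType) (X : completeMetricType R).
Variables (p : R) (m : {finite_measure set (borel X) -> \bar R}).
Hypothesis p_gt0 : 0 < p.

Lemma Lplus_scale (c : R) (h : borel X -> \bar R) : 0 <= c -> Lplus p m h ->
  Lplus p m (fun x => c%:E * h x)%E /\
  (\int[m]_x ((c%:E * h x) `^ p) = (c `^ p)%:E * \int[m]_x (h x `^ p))%E.
Proof.
move=> c0 [mh h0 hp].
have E : (\int[m]_x ((c%:E * h x) `^ p) = (c `^ p)%:E * \int[m]_x (h x `^ p))%E.
  under eq_integral do rewrite poweRM ?lee_fin//.
  rewrite ge0_integralZl//= ?lee_fin ?powR_ge0//.
    exact: (measurableT_comp (measurable_poweR p)).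
  by move=> x _; exact: poweR_ge0.
split=> //; split.
- exact: measurable_funeM.
- by move=> x; rewrite mule_ge0.
- by rewrite E lte_mul_pinfty ?lee_fin ?powR_ge0.
Qed.

(** Every positive multiple of [h] is admissible, because the integrals are infinite, and a small
    multiple has small energy. This is the easy converse of Fuglede's lemma. *)
Lemma Mod_infinite (S : set {measure set (borel X) -> \bar R}) (h : borel X -> \bar R) :
  Lplus p m h -> (forall nu, S nu -> (\int[nu]_x h x = +oo)%E) -> Mod p m S = 0%E.
Proof.
move=> Lh hS; apply/eqP; rewrite eq_le; apply/andP; split; last first.
  apply: le_ereal_inf_tmp => _ [k _ <-]; apply: integral_ge0 => x _; exact: poweR_ge0.
have [_ h0 hfin] := Lh.
have I0 : (0 <= \int[m]_x (h x `^ p))%E.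
  by apply: integral_ge0 => x _; exact: poweR_ge0.
have /fineK IE : (\int[m]_x (h x `^ p))%E \is a fin_num by rewrite ge0_fin_numE.
set I := fine _ in IE.
have I'0 : 0 <= I by rewrite -lee_fin IE.
apply/lee_addgt0Pr => e e0; rewrite add0e.
(* Scaling [h] by the p-th root of e / (I + 1) multiplies its energy [I] by that ratio, which leaves
   at most [e]; the summand 1 covers I = 0. *)
have d0 : 0 < e / (I + 1) by rewrite divr_gt0// ltr_wpDl.
set d := e / (I + 1) in d0.
have c0 : 0 <= d `^ p^-1 by exact: powR_ge0.
have [Lc Ec] := Lplus_scale c0 Lh.
apply: ge_ereal_inf; exists (\int[m]_x ((d `^ p^-1)%:E * h x) `^ p)%E.
  exists (fun x => (d `^ p^-1)%:E * h x)%E => //; split=> // nu Snu.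
  have [mh _ _] := Lh.
  rewrite ge0_integralZl//= hS// mulry gtr0_sg ?mul1e ?leey//.
  exact: powR_gt0.
rewrite Ec -powRrM mulVf ?gt_eqF// powRr1 ?(ltW d0)// -IE -EFinM lee_fin.
by rewrite /d mulrAC ler_pdivrMr ?ltr_wpDl// ler_wpM2l ?(ltW e0)// lerDl.
Qed.

(* Fuglede: near-optimal admissible functions h_n with rapidly decaying energy;
   the p-th power of the limit function is the sum of those of n h_n. *)
Lemma Mod0_infinite (S : set {measure set (borel X) -> \bar R}) :
  Mod p m S = 0%E ->
  exists2 h, Lplus p m h & forall nu, S nu -> (\int[nu]_x h x = +oo)%E.
Proof.
move=> S0.
(* The first factor absorbs the later multiplication of the n-th function by n + 1, so that [K n]
   has energy at most 2^-(n+1), and these bounds sum to 1. *)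
pose e n : R := (n.+1%:R `^ p)^-1 * (1 / (2 ^ n.+1)%:R).
have e0 n : 0 < e n by rewrite mulr_gt0 ?invr_gt0 ?powR_gt0// divr_gt0 ?ltr0n ?expn_gt0.
have /choice[H HP] n : exists h, [/\ Lplus p m h,
    (forall nu, S nu -> (1 <= \int[nu]_x h x)%E) &
    (\int[m]_x (h x `^ p) < (e n)%:E)%E].
  have : (Mod p m S < (e n)%:E)%E by rewrite S0 lte_fin.
  by move=> /ereal_inf_lt[_ [h [Lh hS] <-] hn]; exists h; split.
pose K n x := (n.+1%:R%:E * H n x)%E.
have n0 n : 0 <= n.+1%:R :> R by [].
have LK n : Lplus p m (K n).
  by have [LH _ _] := HP n; exact: (Lplus_scale (n0 n) LH).1.
pose s x := (\sum_(0 <= n <oo) (K n x `^ p))%E.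
have s0 x : (0 <= s x)%E by apply: nneseries_ge0 => n _ _; exact: poweR_ge0.
have mKp n : measurable_fun [set: borel X] (fun x => K n x `^ p)%E.
  have [mK _ _] := LK n.
  exact: (measurableT_comp (measurable_poweR p)).
have ms : measurable_fun [set: borel X] s.
  by apply: ge0_emeasurable_sum => // n x _ _; exact: poweR_ge0.
have sp x : ((s x `^ p^-1) `^ p)%E = s x.
  by rewrite -poweRrM mulVf ?gt_eqF// poweRe1.
exists (fun x => s x `^ p^-1)%E.
  split.
  - exact: (measurableT_comp (measurable_poweR p^-1)).
  - by move=> x; exact: poweR_ge0.
  - under eq_integral do rewrite sp.
    rewrite integral_nneseries//; last by move=> n x _; exact: poweR_ge0.
    apply: (@le_lt_trans _ _ 1%:E); last exact: ltry.
    apply: (@le_trans _ _ (\sum_(0 <= n <oo) (1 / (2 ^ n.+1)%:R)%:E)%E); last first.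
      exact: epsilon_trick0.
    apply: lee_nneseries => n _.
      by move=> _; apply: integral_ge0 => x _; exact: poweR_ge0.
    have [LH _ /ltW He] := HP n.
    rewrite (Lplus_scale (n0 n) LH).2.
    apply: (le_trans (lee_wpmul2l _ He)); first by rewrite lee_fin powR_ge0.
    by rewrite -EFinM lee_fin /e mulVKf ?gt_eqF// powR_gt0.
move=> nu Snu; apply/eqyP => A A0.
(* The single function [K n] already has integral at least n + 1 >= A, and it lies below the p-th
   root of the series. *)
pose n := `|Num.ceil A|%N.
have An : A <= n.+1%:R.
  by rewrite (le_trans (ceil_ge _))// -natr1 /n natr_absz ler_wpDr// ler_int lez_abs.
have [[mH H0 _] /(_ _ Snu) H1 _] := HP n.
apply: (@le_trans _ _ (\int[nu]_x (K n x))%E).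
  rewrite /K ge0_integralZl//=.
  apply: (@le_trans _ _ (n.+1%:R%:E * 1)%E); first by rewrite mule1 lee_fin.
  by rewrite lee_wpmul2l.
have [mK K0 _] := LK n.
apply: ge0_le_integral => //.
  exact: (measurableT_comp (measurable_poweR p^-1)).
move=> x _; have -> : K n x = ((K n x `^ p) `^ p^-1)%E.
  by rewrite -poweRrM mulfV ?gt_eqF// poweRe1.
apply: gt0_ler_poweR; rewrite ?invr_ge0 ?(ltW p_gt0)// ?in_itv/= ?leey ?andbT//.
  exact: poweR_ge0.
have := @nneseries_lim_ge _ (fun n => K n x `^ p)%E xpredT 0 n.+1.
rewrite big_nat_recr//= => Kle; apply: le_trans (Kle _).
  rewrite leeDr// sume_ge0// => i _; exact: poweR_ge0.
by move=> i _ _; exact: poweR_ge0.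
Qed.

End modulus.

(** * The metric derivative *)

Section primitive.
Context {R : realType}.
Local Notation mu := (@lebesgue_measure R).
Implicit Type U : R -> R.

(** Based at -oo, so that increments need no case distinction on the sign of [t]. *)
Definition prim U (t : R) : R := \int[mu]_(x in `]-oo, t]) U x.

Lemma integrable_patch U (A : set R) : measurable A ->
  mu.-integrable setT (EFin \o U) -> mu.-integrable setT (EFin \o (U \_ A)).
Proof.
move=> mA iU; rewrite -restrict_EFin.
have iUA : mu.-integrable A (EFin \o U) by exact: integrableS iU.
exact: (proj1 (integrable_mkcond _ _)).
Qed.

Lemma primB U a b : mu.-integrable setT (EFin \o U) -> a <= b ->
  prim U b - prim U a = \int[mu]_(x in `]a, b]) U x.
Proof.
move=> iU ab; rewrite /prim Rintegral_itvB//.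
exact: integrableS iU.
Qed.

Lemma EFin_primB U a b : mu.-integrable setT (EFin \o U) -> a <= b ->
  ((prim U b - prim U a)%:E = \int[mu]_(x in `[a, b]) (U x)%:E)%E.
Proof.
move=> iU ab; rewrite primB// /Rintegral fineK; last first.
  by apply: integrable_fin_num => //; exact: integrableS iU.
rewrite integral_itv_obnd_cbnd//.
by apply: measurable_funTS; exact: (measurable_int mu).
Qed.

Lemma prim_le U a b : mu.-integrable setT (EFin \o U) -> (forall x, 0 <= U x) ->
  a <= b -> prim U a <= prim U b.
Proof.
by move=> iU U0 ab; rewrite -subr_ge0 primB//; apply: Rintegral_ge0.
Qed.

Lemma prim_continuous U : mu.-integrable setT (EFin \o U) -> continuous (prim U).
Proof.
move=> iU t; apply/cvgrPdist_lt => e e0.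
have [d [d0 dP]] := integral_normr_continuous iU e0.
have key a b : a <= b -> b - a < d -> `|prim U b - prim U a| < e.
  move=> ab bad; rewrite primB//.
  apply: le_lt_trans (dP `]a, b]%classic _ _) => //.
    by apply: le_normr_Rintegral => //; exact: integrableS iU.
  suff : (mu `]a, b]%classic < d%:E)%E by [].
  by rewrite lebesgue_measure_itv/= lte_fin; case: ifPn.
near=> s; have : `|t - s| < d by near: s; exact: cvgr_dist_lt.
have [ts|/ltW st] := leP t s => tsd.
  by rewrite distrC; apply: key => //; move: tsd; rewrite ler0_norm ?subr_le0// opprB.
by apply: key => //; move: tsd; rewrite ger0_norm ?subr_ge0.
Unshelve. all: by end_near. Qed.

Lemma ae_lebesgue_pt U : mu.-integrable setT (EFin \o U) ->
  \forall t \ae mu, lebesgue_pt U t.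
Proof.
move=> iU; apply: lebesgue_differentiation.
by apply: open_integrable_locally => //; exact: openT.
Qed.

Lemma lebesgue_pt_prim U t : mu.-integrable setT (EFin \o U) -> lebesgue_pt U t ->
  (prim U (t + h) - prim U t) / h @[h --> 0^'] --> U t.
Proof.
move=> iU Ut; have t1 : t < t + 1 by rewrite ltrDl.
have iU1 : mu.-integrable `]-oo, t + 1] (EFin \o U) by exact: integrableS iU.
have [] := FTC1_lebesgue_pt t1 iU1 (ltNyr _) Ut.
rewrite -/(prim U) => /cvg_ex[/= l Hl].
rewrite derive1E /derive (cvg_lim _ Hl)// => <-.
apply: cvg_trans Hl; apply: near_eq_cvg; near=> h.
by rewrite /= scaler1 mulrC [h + t]addrC.
Unshelve. all: by end_near. Qed.

End primitive.

(** * Increment estimates by continuous induction *)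

Section creep.
Context {R : realType}.
Variables (d : R -> R -> R) (G : R -> R).
Hypotheses (dxx : forall a, d a a = 0)
  (dD : forall a b c, d a c <= d a b + d b c)
  (dcont : forall a, continuous (d a))
  (Gcont : continuous G).

(** Continuous induction: the supremum [c] of the times up to which the estimate from [a] holds
    satisfies it too, by continuity, and the step available at [c] would lead beyond it unless c =
    b. The steps may have any length, so they cannot simply be iterated. *)
Lemma creep_right (a b : R) : a <= b ->
  (forall c, a <= c -> c < b ->
    exists2 h, 0 < h <= b - c & d c (c + h) <= G (c + h) - G c) ->
  d a b <= G b - G a.
Proof.
move=> ab step.
pose S := [set t | a <= t <= b /\ d a t <= G t - G a].
have Sa : S a by split; rewrite ?lexx ?ab// dxx subrr.
have hS : has_sup S by split; [exists a|exists b => t [/andP[]]].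
set c := sup S.
have ac : a <= c by exact: sup_upper_bound.
have cb : c <= b by apply: ge_sup; [exists a|move=> t [/andP[]]].
have Sc : S c.
  split; first by rewrite ac.
  rewrite leNgt; apply/negP => lt.
  have : \forall t \near c, 0 < d a t - G t + G a.
    have : d a t - G t + G a @[t --> c] --> d a c - G c + G a.
      by apply: cvgD; [apply: cvgB; [exact: dcont|exact: Gcont]|exact: cvg_cst].
    move=> /cvgr_gt; apply; lra.
  move=> /nbhs_ballP[e /= e0 He].
  have [t [tab tS] ct] := sup_adherent e0 hS.
  have tc : t <= c by exact: sup_upper_bound.
  have := He t; rewrite /ball/= ger0_norm ?subr_ge0// => /(_ _).
  suff -> : c - t < e by move=> /(_ isT); lra.
  by move: ct; rewrite -/c; lra.
have [->//|cnb] := eqVneq b c; first by case: Sc.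
have /step[//|h /andP[h0 hb] hG] : c < b by rewrite lt_neqAle eq_sym cnb.
have : S (c + h).
  split; first by apply/andP; split; lra.
  have [_ Sc2] := Sc; have := dD a c (c + h); lra.
by move/(sup_upper_bound hS); rewrite -/c; lra.
Qed.
End creep.

Section creep_sided.
Context {R : realType}.
Variables (d : R -> R -> R) (G : R -> R).
Hypotheses (dxx : forall a, d a a = 0)
  (dC : forall a b, d a b = d b a)
  (dD : forall a b c, d a c <= d a b + d b c)
  (dcont : forall a, continuous (d a))
  (Gcont : continuous G).

(** The case s = -1 is the case s = 1 for the reflected line, where backward steps become forward
    ones. *)
Lemma creep (s : R) (a b : R) : (s = 1 \/ s = -1) -> a <= b ->
  (forall c e, 0 < e ->
    exists2 h, 0 < h < e & d c (c + s * h) <= s * (G (c + s * h) - G c)) ->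
  d a b <= G b - G a.
Proof.
move=> s1 ab step; case: s1 => s1; rewrite {}s1 in step.
  apply: creep_right => // c ac cb.
  have [|h /andP[h0 hbc]] := step c (b - c); first by rewrite subr_gt0.
  by rewrite !mul1r => ?; exists h => //; rewrite h0 ltW.
have := @creep_right _ (fun x y => d (- x) (- y)) (fun x => - G (- x)) _ _ _ _ (- b) (- a).
rewrite !opprK addrC dC; apply => //; last 2 first.
- by rewrite lerN2.
- move=> c bc ca; have [|h /andP[h0 hbc]] := step (- c) (- a - c); first by rewrite subr_gt0.
  rewrite mulN1r => dG; exists h; first by rewrite h0 ltW.
  by rewrite opprD opprK; move: dG; rewrite mulN1r; lra.
- move=> c t; apply: (@continuous_comp _ _ _ -%R); last exact: dcont.
  exact: opp_continuous.
- move=> t; apply: cvgN; apply: (@continuous_comp _ _ _ -%R); last exact: Gcont.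
  exact: opp_continuous.
Qed.
End creep_sided.

Section metric_derivative.
Context {R : realType}.
Local Notation mu := (@lebesgue_measure R).
Variables (d : R -> R -> R) (V : R -> R).
Hypotheses (dxx : forall a, d a a = 0)
  (dC : forall a b, d a b = d b a)
  (d_ge0 : forall a b, 0 <= d a b)
  (dD : forall a b c, d a c <= d a b + d b c)
  (iV : mu.-integrable setT (EFin \o V))
  (V0 : forall x, 0 <= V x)
  (dV : forall a b, a <= b -> d a b <= prim V b - prim V a).

(** In each variable [d] changes by at most an increment of the continuous function [prim V]; the
    triangle inequality makes this joint continuity. *)
Lemma dist_cvg (f g : R -> R) t : {for t, continuous f} -> {for t, continuous g} ->
  d (f s) (g s) @[s --> t] --> d (f t) (g t).
Proof.
move=> cf cg; apply/cvgrPdist_lt => e e0.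
have dV' a b : d a b <= `|prim V a - prim V b|.
  have [ab|/ltW ba] := leP a b.
    by rewrite distrC; apply: le_trans (dV ab) (ler_norm _).
  by rewrite dC; apply: le_trans (dV ba) (ler_norm _).
have e20 : 0 < e / 2 by rewrite divr_gt0.
have pf (k : R -> R) : {for t, continuous k} ->
    \forall s \near t, `|prim V (k t) - prim V (k s)| < e / 2.
  move=> ck; have : (prim V \o k) s @[s --> t] --> (prim V \o k) t.
    by apply: (@continuous_comp _ _ _ k (prim V)) => //; exact: prim_continuous.
  by move/cvgrPdist_lt; exact.
near=> s.
have d1 : d (f t) (f s) < e / 2.
  by apply: le_lt_trans (dV' _ _) _; near: s; exact: pf.
have d2 : d (g t) (g s) < e / 2.
  by apply: le_lt_trans (dV' _ _) _; near: s; exact: pf.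
have := dD (f t) (f s) (g t).
have := dD (f s) (f t) (g s).
have := dD (f t) (g t) (g s).
have := dD (f s) (g s) (g t).
rewrite (dC (g s)) (dC (f s) (f t)) ltr_norml => *; apply/andP; split; lra.
Unshelve. all: by end_near. Qed.

(** The exceptional null set is covered by an open set [B] so small that the integral of [V] over it
    is at most [e]. Inside [B] a step is paid for by [V], outside by the slope l + e, and [creep]
    combines both kinds of steps into one estimate. *)
Lemma dist_le_prim (s : R) (l : R -> R) a b : s = 1 \/ s = -1 ->
  mu.-integrable setT (EFin \o l) -> (forall x, 0 <= l x) ->
  (\forall t \ae mu, forall e del, 0 < e -> 0 < del ->
     exists2 h, 0 < h < del & d t (t + s * h) <= (l t + e) * h) ->
  a <= b -> d a b <= prim l b - prim l a.
Proof.
move=> s1 il l0 ael ab.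
have [Z [mZ Z0 HZ]] : mu.-negligible (~` [set t | lebesgue_pt l t /\
    forall e del, 0 < e -> 0 < del ->
     exists2 h, 0 < h < del & d t (t + s * h) <= (l t + e) * h]).
  by have := negligibleU (ae_lebesgue_pt il) ael; rewrite -setCI.
apply/ler_addgt0Pr => e0 e00.
(* The budget [e0] covers a slope error [e] over the length b - a and an integral of [V] over [B] of
   at most [e]. *)
pose e := e0 / (b - a + 1).
have e_gt0 : 0 < e by rewrite divr_gt0// ltr_wpDl// subr_ge0.
have -> : e0 = e * (b - a) + e.
  by rewrite -{2}[e]mulr1 -mulrDr /e divfK// gt_eqF// ltr_wpDl// subr_ge0.
have [del [del0 delV]] := integral_normr_continuous iV e_gt0.
have [B [oB ZB]] : exists B : set R, [/\ open B, Z `<=` B & (mu (B `\` Z) < del%:E)%E].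
  have Zy : (mu Z < +oo)%E by rewrite Z0.
  exact: lebesgue_regularity_outer.
have mB : measurable B by exact: open_measurable.
move=> muO0.
have muO : (mu B < del%:E)%E.
  have : (mu Z + mu (B `\` Z) < del%:E)%E by rewrite Z0 add0e.
  rewrite -{2}(setDUK ZB); apply: le_lt_trans; apply: measureU2 => //.
  exact: measurableD.
pose W := V \_ B.
have W0 x : 0 <= W x by rewrite /W patchE; case: ifP.
have iW : mu.-integrable setT (EFin \o W) by exact: integrable_patch.
pose G t := prim l t + prim W t + e * t.
have Gc : continuous G.
  move=> t; apply: cvgD; first by apply: cvgD; exact: prim_continuous.
  by apply: cvgMr; exact: cvg_id.
have WV x y : x <= y -> `[x, y] `<=` B -> prim W y - prim W x = prim V y - prim V x.
  move=> xy xyO; rewrite !primB//; apply: eq_Rintegral => z.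
  rewrite inE/= => zxy; rewrite /W patchE mem_set//; apply: xyO.
  exact: subset_itv_oc_cc zxy.
have dW x y : x <= y -> `[x, y] `<=` B -> d x y <= prim W y - prim W x.
  by move=> xy xyO; rewrite WV//; exact: dV.
have lemono x y : x <= y -> prim l x <= prim l y by exact: prim_le.
have Wmono x y : x <= y -> prim W x <= prim W y by exact: prim_le.
have dG : d a b <= G b - G a.
  apply: (@creep _ d G dxx dC dD _ Gc s) => //.
    by move=> c t; apply: dist_cvg; [exact: cst_continuous|exact: cvg_id].
  move=> c r r0; have [Oc|Oc] := pselect (B c).
    have [q /= q0 qB] : \forall x \near c, B x by exact: open_nbhs_nbhs.
    pose h := Num.min q r / 2.
    have h0 : 0 < h by rewrite divr_gt0// lt_min q0.
    have hmin : h < Num.min q r by rewrite /h ltr_pdivrMr// ltr_pMr ?ltr1n// lt_min q0.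
    have [hq hr] : h < q /\ h < r by move: hmin; rewrite lt_min => /andP.
    exists h; first by rewrite h0.
    have sub x y : c - h <= x -> y <= c + h -> `[x, y] `<=` B.
      move=> cx yc z /=; rewrite in_itv/= => /andP[xz zy].
      by apply: qB; rewrite /= ltr_norml; apply/andP; split; lra.
    case: s1 => ->; rewrite /G.
      have hc : c <= c + 1 * h by lra.
      have := lemono _ _ hc.
      have := dW c (c + 1 * h) hc (sub _ _ _ _).
      have : 0 <= e * h by rewrite mulr_ge0// ltW.
      by rewrite !mul1r mulrDr; lra.
    have hc : c + -1 * h <= c by lra.
    have := lemono _ _ hc.
    have := dW (c + -1 * h) c hc (sub _ _ _ _).
    have : 0 <= e * h by rewrite mulr_ge0// ltW.
    by rewrite !mulN1r mulrDr (dC (c - h)); lra.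
  have [lc Hc] : lebesgue_pt l c /\ forall e del, 0 < e -> 0 < del ->
     exists2 h, 0 < h < del & d c (c + s * h) <= (l c + e) * h.
    by apply: contrapT => nc; apply: Oc; apply: ZB; apply: HZ.
  (* Half of [e] is spent on the assumed bound for [d], half on the convergence of the difference
     quotients of [prim l] at the Lebesgue point [c]. *)
  have e2 : 0 < e / 2 by rewrite divr_gt0.
  have /cvgrPdist_lt/(_ _ e2) := lebesgue_pt_prim il lc.
  rewrite near_withinE => /nbhs_ballP[q /= q0 Hq].
  have [h /andP[h0 hmin] dh] := Hc (e / 2) (Num.min q r) e2 ltac:(by rewrite lt_min q0).
  have [hq hr] : h < q /\ h < r by move: hmin; rewrite lt_min => /andP.
  exists h; first by rewrite h0.
  have sn0 : s != 0 by case: s1 => ->; rewrite ?oppr_eq0 oner_eq0.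
  have := Hq (s * h).
  rewrite /ball/= sub0r normrN normrM (_ : `|s| = 1); last first.
    by case: s1 => ->; rewrite ?normrN normr1.
  rewrite mul1r gtr0_norm// => /(_ hq); rewrite mulf_neq0//; last by rewrite gt_eqF.
  move=> /(_ isT) Hl.
  have lh : (l c - e / 2) * h <= s * (prim l (c + s * h) - prim l c).
    have -> : s * (prim l (c + s * h) - prim l c) =
        (prim l (c + s * h) - prim l c) / (s * h) * h.
      rewrite invfM mulrA divfK ?gt_eqF// mulrC; congr (_ * _).
      by case: s1 => ->; rewrite ?invrN invr1.
    rewrite ler_pM2r//; move: Hl; rewrite ltr_norml => /andP[_]; lra.
  have Ws : 0 <= s * (prim W (c + s * h) - prim W c).
    case: s1 => ->.
      by rewrite !mul1r subr_ge0 Wmono// lerDl ltW.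
    by rewrite !mulN1r opprB subr_ge0 Wmono// gerBl ltW.
  have se : s * (e * (c + s * h)  - e * c) = e * h.
    by case: s1 => ->; ring.
  have -> : s * (G (c + s * h) - G c) = s * (prim l (c + s * h) - prim l c) +
     s * (prim W (c + s * h) - prim W c) + s * (e * (c + s * h)  - e * c).
    by rewrite /G; ring.
  rewrite se; nra.
have : prim W b - prim W a <= e.
  rewrite primB//; apply: le_trans (ltW (delV B mB muO)).
  rewrite /W Rintegral_mkcond [leRHS]Rintegral_mkcond.
  apply: le_Rintegral => //.
  - exact: integrable_patch.
  - exact: (integrable_patch _ (integrable_norm iV)).
  - move=> x _; rewrite !patchE; case: ifP => _; case: ifP => // _.
      exact: ler_norm.
    by rewrite normr_ge0.
move: dG; rewrite /G; lra.
Qed.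

(* As an infimum of continuous functions, the n-th approximation is upper
   semicontinuous, hence Borel. *)
Let lowder_n (s : R) (n : nat) (t : R) : \bar R :=
  ereal_inf [set (d t (t + s * h) / h)%:E | h in `]0, n.+1%:R^-1[].

(** The infima increase with [n], so this supremum is the lower derivative on the side [s]: the
    limit inferior of d t (t + s h) / h as h decreases to 0. *)
Let lowder (s : R) (t : R) : \bar R := esups (lowder_n s ^~ t) 0.

Let lowder_n_ge0 s n t : (0 <= lowder_n s n t)%E.
Proof.
apply: le_ereal_inf_tmp => _ [h /=] /[!in_itv]/= /andP[h0 _] <-.
by rewrite lee_fin divr_ge0// ltW.
Qed.

Let measurable_lowder_n s n : measurable_fun setT (lowder_n s n).
Proof.
apply: (measurability _ (ErealGenInftyO.measurableE R)) => // _ [_ [c ->] <-].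
rewrite setTI (_ : _ @^-1` _ = \bigcup_(h in `]0, n.+1%:R^-1[)
    (fun t => d t (t + s * h) / h) @^-1` [set x : R | x < c]); last first.
  apply/seteqP; split=> t /=.
    rewrite in_itv/= => /ereal_inf_lt[_ [h hn <-]]; rewrite lte_fin => hc.
    by exists h.
  move=> [h hn /= hc]; rewrite in_itv/=.
  apply: (@le_lt_trans _ _ (d t (t + s * h) / h)%:E); last by rewrite lte_fin.
  by apply: ereal_inf_lbound; exists h.
apply: open_measurable; apply: bigcup_open => h _.
apply: open_comp; last exact: open_lt.
move=> t _; apply: cvgMl; apply: dist_cvg; first exact: cvg_id.
by apply: cvgD; [exact: cvg_id|exact: cvg_cst].
Qed.

Let measurable_lowder s : measurable_fun setT (lowder s).
Proof. by apply: measurable_fun_esups => n; exact: measurable_lowder_n. Qed.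

Let lowder_n_le s n t : (lowder_n s n t <= lowder s t)%E.
Proof. by apply: ereal_sup_ubound; exists n. Qed.

Let lowder_ge0 s t : (0 <= lowder s t)%E.
Proof. exact: le_trans (lowder_n_ge0 s 0 t) (lowder_n_le s 0 t). Qed.

Let near_dist_le (l : R -> R) t e : mu.-integrable setT (EFin \o l) ->
  lebesgue_pt l t -> (forall a b, a <= b -> d a b <= prim l b - prim l a) ->
  0 < e -> exists2 r, 0 < r & forall k, 0 < `|k| < r -> d t (t + k) <= (l t + e) * `|k|.
Proof.
move=> il lt dl e0; have /cvgrPdist_lt/(_ _ e0) := lebesgue_pt_prim il lt.
rewrite near_withinE => /nbhs_ballP[r /= r0 Hr]; exists r => // k /andP[k0 kr].
have k0' : k != 0 by rewrite -normr_gt0.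
have := Hr k; rewrite /ball/= sub0r normrN => /(_ kr k0').
rewrite ltr_norml => /andP[+ _].
set D := _ - prim l t => HD.
have : D / k < l t + e by lra.
have [kp|kn|kz] := ltgtP k 0; last by rewrite kz eqxx in k0'.
  rewrite ltr_ndivrMr// ltr0_norm// => Dk.
  have tk : t + k <= t by lra.
  by rewrite dC; have := dl _ _ tk; rewrite /D in Dk *; lra.
rewrite ltr_pdivrMr// gtr0_norm// => Dk.
have tk : t <= t + k by lra.
by have := dl _ _ tk; rewrite /D in Dk *; lra.
Qed.

Let lowder_le (l : R -> R) s t : s = 1 \/ s = -1 -> mu.-integrable setT (EFin \o l) ->
  lebesgue_pt l t -> (forall a b, a <= b -> d a b <= prim l b - prim l a) ->
  (lowder s t <= (l t)%:E)%E.
Proof.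
move=> s1 il lt dl; apply: ge_ereal_sup => _ [n _ <-].
apply/lee_addgt0Pr => e e0; have [r r0 Hr] := near_dist_le il lt dl e0.
pose h := Num.min r n.+1%:R^-1 / 2.
have m0 : 0 < Num.min r n.+1%:R^-1 by rewrite lt_min r0 invr_gt0 ltr0n.
have h0 : 0 < h by rewrite divr_gt0.
have : h < Num.min r n.+1%:R^-1 by rewrite /h ltr_pdivrMr// ltr_pMr ?ltr1n.
rewrite lt_min => /andP[hr hn].
have sh : `|s * h| = h.
  by case: s1 => ->; rewrite ?mulN1r ?mul1r ?normrN gtr0_norm.
apply: (@le_trans _ _ (d t (t + s * h) / h)%:E).
  by apply: ereal_inf_lbound; exists h => //=; rewrite in_itv/= h0.
rewrite -EFinD lee_fin ler_pdivrMr//.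
by have := Hr (s * h); rewrite sh h0 => /(_ hr).
Qed.

Let lowder_step s t e del : (lowder s t < +oo)%E -> 0 < e -> 0 < del ->
  exists2 h, 0 < h < del & d t (t + s * h) <= (fine (lowder s t) + e) * h.
Proof.
move=> loo e0 del0.
have [n _ /(_ _ (leqnn n)) nd] := near_infty_natSinv_lt (PosNum del0).
have lf : lowder s t \is a fin_num by rewrite ge0_fin_numE.
have : (lowder_n s n t < (fine (lowder s t) + e)%:E)%E.
  apply: le_lt_trans (lowder_n_le s n t) _.
  by rewrite EFinD fineK// lteDl ?lte_fin.
move=> /ereal_inf_lt[_ [h /=] /[!in_itv]/= /andP[h0 hn] <-].
rewrite lte_fin ltr_pdivrMr// => /ltW H; exists h => //.
by rewrite h0 (lt_trans hn).
Qed.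

(* Right and left lower derivatives both dominate [d] when integrated, and both
   are dominated by any integrable function with this property; so they agree
   with the upper derivatives almost everywhere. *)
Theorem metric_derivative : exists l : R -> R,
  [/\ mu.-integrable setT (EFin \o l), forall x, 0 <= l x,
      forall a b, a <= b -> d a b <= prim l b - prim l a &
      \forall t \ae mu, d t (t + h) / `|h| @[h --> 0^'] --> l t].
Proof.
pose l s t := fine (lowder s t).
have l0 s t : 0 <= l s t by exact/fine_ge0/lowder_ge0.
have aeV := ae_lebesgue_pt iV.
have ml s : measurable_fun setT (l s).
  exact: (measurableT_comp (fine_measurable measurableT) (measurable_lowder s)).
have il s : s = 1 \/ s = -1 -> mu.-integrable setT (EFin \o l s).
  have mV : measurable_fun setT (EFin \o V) by exact: (measurable_int mu).
  move=> s1; apply/integrableP; split; first by apply/measurable_EFinP; exact: ml.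
  have /integrableP[_] := iV; apply: le_lt_trans; apply: ae_ge0_le_integral => //.
  - by apply: measurableT_comp => //; apply/measurable_EFinP; exact: ml.
  - exact: measurableT_comp.
  apply: (negligibleS _ aeV) => t /=; apply: contra_not => Vt _ /=.
  rewrite !ger0_norm//; have lle := lowder_le s1 iV Vt dV.
  by rewrite /l fineK// ge0_fin_numE// (le_lt_trans lle) ?ltry.
have aefin s : s = 1 \/ s = -1 -> \forall t \ae mu, (lowder s t < +oo)%E.
  move=> s1; apply: (negligibleS _ aeV) => t /=; apply: contra_not => Vt.
  by rewrite (le_lt_trans (lowder_le s1 iV Vt dV)) ?ltry.
have dl s : s = 1 \/ s = -1 -> forall a b, a <= b -> d a b <= prim (l s) b - prim (l s) a.
  move=> s1 a b ab; apply: (@dist_le_prim s) => //; first exact: il.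
  apply: (negligibleS _ (aefin _ s1)) => t /=; apply: contra_not => Ht e del e0 del0.
  exact: lowder_step.
have s1 : (1 : R) = 1 \/ (1 : R) = -1 by left.
have sN1 : (-1 : R) = 1 \/ (-1 : R) = -1 by right.
exists (l 1); split=> //; [exact: il|exact: dl|].
have H1 := negligibleU (ae_lebesgue_pt (il _ s1)) (aefin _ s1).
have H2 := negligibleU (ae_lebesgue_pt (il _ sN1)) (aefin _ sN1).
apply: negligibleS (negligibleU H1 H2) => t nP; apply: contrapT.
move=> /not_orP[/not_orP[/contrapT p1 /contrapT f1]].
move=> /not_orP[/contrapT p2 /contrapT f2]; apply: nP => /=.
have fin1 : lowder 1 t \is a fin_num by rewrite ge0_fin_numE.
have fin2 : lowder (-1) t \is a fin_num by rewrite ge0_fin_numE.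
have E : l 1 t = l (-1) t.
  have E1 : (l 1 t)%:E = lowder 1 t by exact: fineK.
  have E2 : (l (-1) t)%:E = lowder (-1) t by exact: fineK.
  apply/eqP; rewrite eq_le -!lee_fin; apply/andP; split.
    by rewrite E1; exact: (lowder_le s1 (il _ sN1) p2 (dl _ sN1)).
  by rewrite E2; exact: (lowder_le sN1 (il _ s1) p1 (dl _ s1)).
(* The lower bounds on the two sides come from the two lower derivatives, which [E] identifies; the
   upper bound [R3] serves both sides at once. *)
have low s e : 0 < e -> lowder s t \is a fin_num ->
    exists2 r, 0 < r & forall h, 0 < h < r -> (l s t - e) * h <= d t (t + s * h).
  move=> e0 fs.
  have Es : (l s t)%:E = lowder s t by exact: fineK.
  have : (((l s t - e)%:E) < lowder s t)%E by rewrite -Es lte_fin ltrBlDr ltrDl.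
  move=> /ereal_sup_gt[_ [n _ <-]] /= Hn.
  exists n.+1%:R^-1; first by rewrite invr_gt0.
  move=> h /andP[h0 hn]; rewrite -ler_pdivlMr// -lee_fin.
  apply: le_trans (ltW Hn) _.
  by apply: ereal_inf_lbound; exists h => //=; rewrite in_itv/= h0.
apply/cvgrPdist_le => e e0.
have [r1 r10 R1] := low 1 _ e0 fin1.
have [r2 r20 R2] := low (-1) _ e0 fin2.
have [r3 r30 R3] := near_dist_le (il _ s1) p1 (dl _ s1) e0.
near=> k.
have k0 : k != 0 by near: k; exact: nbhs_dnbhs_neq.
have kr : `|k| < Num.min r1 (Num.min r2 r3).
  near: k; apply: dnbhs0_lt; by rewrite !lt_min r10 r20.
move: kr; rewrite !lt_min => /and3P[k1 k2 k3].
have kp : 0 < `|k| by rewrite normr_gt0.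
rewrite ler_distlC; apply/andP; split; last first.
  by rewrite ler_pdivrMr// R3// kp.
rewrite ler_pdivlMr//.
have [kn|kp'] := leP k 0.
  rewrite ler0_norm// E; have := R2 (- k).
  rewrite mulN1r opprK; apply; rewrite -(ler0_norm kn); by rewrite kp.
rewrite gtr0_norm//; have := R1 k.
by rewrite mul1r; apply; rewrite kp' -(gtr0_norm kp').
Unshelve. all: by end_near. Qed.

End metric_derivative.

(** * Substitution and reparametrization *)

Import HBNNSimple.

Section density.
Local Open Scope ereal_scope.
Context d (T : measurableType d) (R : realType).
Variables (nu mu : {measure set T -> \bar R}) (u : T -> R).
Hypotheses (mu_ : measurable_fun setT u) (u0 : forall x, (0 <= u x)%R)
  (nuE : forall A, measurable A -> nu A = \int[mu]_(x in A) (u x)%:E).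

Let ge0_integral_density_nnsfun (h : {nnsfun T >-> R}) :
  \int[nu]_x (h x)%:E = \int[mu]_x ((h x)%:E * (u x)%:E).
Proof.
have mA y : measurable (h @^-1` [set y]).
  by rewrite -[X in measurable X]setTI; exact: measurable_funP.
rewrite integralT_nnsfun sintegralE.
have E x : (h x)%:E * (u x)%:E =
    \sum_(y \in range h) (y%:E * ((\1_(h @^-1` [set y]) x)%:E * (u x)%:E)).
  rewrite [in LHS]fimfunE -fsumEFin// ge0_mule_fsuml; last first.
    by move=> y; exact: nnfun_muleindic_ge0.
  by apply: eq_fsbigr => y _; rewrite EFinM muleA.
under [RHS]eq_integral do rewrite E.
rewrite ge0_integral_fsum//=; last 2 first.
- move=> y; apply/measurable_funeM/emeasurable_funM; exact/measurable_EFinP.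
- move=> y x _; rewrite muleA; apply: mule_ge0; last by rewrite lee_fin.
  by rewrite -EFinM; exact: nnfun_muleindic_ge0.
apply: eq_fsbigr => y /[!inE] -[t _ yt].
rewrite ge0_integralZl//=; last 3 first.
- apply/emeasurable_funM; exact/measurable_EFinP.
- by move=> x _; rewrite mule_ge0 ?lee_fin.
- by rewrite lee_fin -yt.
congr (_ * _); rewrite nuE// integral_mkcond; apply: eq_integral => x _.
by rewrite patchE indicE; case: ifP => _; rewrite ?mul1e ?mul0e.
Qed.

Lemma ge0_integral_density (f : T -> \bar R) : measurable_fun setT f ->
  (forall x, 0 <= f x) -> \int[nu]_x f x = \int[mu]_x (f x * (u x)%:E).
Proof.
move=> mf f0; pose h := nnsfun_approx measurableT mf.
have hE x : lim ((h n x)%:E @[n --> \oo]) = f x.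
  by apply/cvg_lim => //; exact: cvg_nnsfun_approx.
have huE x : lim ((h n x)%:E * (u x)%:E @[n --> \oo]) = f x * (u x)%:E.
  by apply/cvg_lim => //; apply: cvgeZr => //; exact: cvg_nnsfun_approx.
under eq_integral do rewrite -hE.
under [RHS]eq_integral do rewrite -huE.
rewrite !monotone_convergence//.
- by congr (limn _); apply/funext => n; exact: ge0_integral_density_nnsfun.
- by move=> n; apply/emeasurable_funM; exact/measurable_EFinP.
- by move=> n x _; rewrite mule_ge0 ?lee_fin.
- move=> x _ a b ab; rewrite lee_wpmul2r ?lee_fin//.
  exact/lefP/nd_nnsfun_approx.
- by move=> n; exact/measurable_EFinP.
- by move=> n x _; rewrite lee_fin.
- by move=> x _ a b ab; rewrite lee_fin; exact/lefP/nd_nnsfun_approx.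
Qed.

End density.

(** Continuity of the inverse is a matter of order: [psi z] is within [e] of [psi y] as soon as [z]
    lies between the values of [P] at psi y - e and psi y + e. *)
Lemma increasing_surj_inverse {R : realType} (P : R -> R) :
  (forall a b, a < b -> P a < P b) -> (forall y, exists x, P x = y) ->
  exists psi : R -> R, [/\ cancel P psi, cancel psi P, continuous psi &
    forall a b, (psi a < psi b) = (a < b)].
Proof.
move=> P_lt P_surj.
have P_le a b : (P a <= P b) = (a <= b).
  have [|/P_lt] := leP a b; last by rewrite ltNge => /negbTE.
  by rewrite le_eqVlt => /predU1P[->|/P_lt/ltW //]; rewrite lexx.
have [psi Ppsi] := choice P_surj.
have psi_lt a b : (psi a < psi b) = (a < b).
  by rewrite !ltNge -P_le !Ppsi.
have psiP : cancel P psi.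
  by move=> x; apply/eqP; rewrite eq_le -(P_le _ x) -(P_le x) Ppsi lexx.
exists psi; split=> // y; apply/cvgrPdist_lt => e e0.
near=> z; rewrite ltr_distlC; apply/andP; split.
  rewrite -(psiP (psi y - e)) psi_lt; near: z; apply: lt_nbhsr.
  by rewrite -[ltRHS]Ppsi P_lt// ltrBlDr ltrDl.
rewrite -(psiP (psi y + e)) psi_lt; near: z; apply: lt_nbhsl.
by rewrite -[ltLHS]Ppsi P_lt// ltrDl.
Unshelve. all: by end_near. Qed.

Section substitution.
Context {R : realType}.
Local Notation mu := (@lebesgue_measure R).
Variable u : R -> R.
Hypotheses (iu : mu.-integrable setT (EFin \o (fun x => u x - 1)))
  (u0 : forall x, 0 <= u x) (u_gt0 : \forall x \ae mu, 0 < u x).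

(** Since u - 1, and not [u], is integrable over the line, the primitive of [u] is written as a
    bounded function plus [t]; this form also makes it onto. *)
Let P t := prim (fun x => u x - 1) t + t.

Let measurable_u : measurable_fun setT u.
Proof.
have /measurable_EFinP m1 := measurable_int mu iu.
have -> : u = (fun x => (u x - 1) + 1) by apply/funext => x; rewrite subrK.
exact: measurable_funD.
Qed.

Lemma primD1E a b : a <= b -> ((P b - P a)%:E = \int[mu]_(x in `[a, b]) (u x)%:E)%E.
Proof.
move=> ab; have -> : P b - P a =
    prim (fun x => u x - 1) b - prim (fun x => u x - 1) a + (b - a).
  by rewrite /P; ring.
rewrite EFinD (EFin_primB iu ab).
have -> : (b - a)%:E = (\int[mu]_(x in `[a, b]) (cst 1%:E) x)%E.
  rewrite integral_cst// mul1e.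
  have := lebesgue_measure_itv `[a, b]; rewrite /= lte_fin -EFinD => ->.
  by case: ltP => // ba; rewrite (le_anti (introT andP (conj ab ba))) subrr.
rewrite -integralD//=.
- by apply: eq_integral => x _; rewrite -EFinD subrK.
- exact: integrableS iu.
- apply: (@continuous_compact_integrable _ (cst 1)); first exact: segment_compact.
  by apply: continuous_subspaceT => x; exact: cst_continuous.
Qed.

(** A zero increment would force [u] to vanish almost everywhere on [a, b], an interval of positive
    measure, against [u_gt0]. *)
Lemma primD1_lt a b : a < b -> P a < P b.
Proof.
move=> ab; have := primD1E (ltW ab).
have : (0 <= \int[mu]_(x in `[a, b]) (u x)%:E)%E.
  by apply: integral_ge0 => x _; rewrite lee_fin.
rewrite le_eqVlt => /predU1P[/esym E|+ PE]; last by rewrite -PE lte_fin subr_gt0.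
move=> _; exfalso.
have : (\int[mu]_(x in `[a, b]) `|(u x)%:E| = 0)%E.
  by rewrite -[RHS]E; apply: eq_integral => x _; rewrite gee0_abs ?lee_fin.
move=> /ae_eq_integral_abs -/(_ _) H.
have H1 : ae_eq mu `[a, b]%classic (fun x => (u x)%:E) (cst 0%E).
  by apply: H => //; apply/measurable_EFinP; exact: measurable_funTS.
have [N [mN N0 NP]] := negligibleU H1 u_gt0.
have : (mu `[a, b]%classic <= mu N)%E.
  apply: le_measure; rewrite ?inE// => x xab; apply: NP.
  apply: contrapT => /not_orP[/contrapT /(_ xab) /= [+] /contrapT /= ux].
  by move=> u_0; rewrite u_0 ltxx in ux.
rewrite [leRHS]N0 lebesgue_measure_itv/= lte_fin ab -EFinD lee_fin.
lra.
Qed.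

Let P_continuous : continuous P.
Proof. by move=> t; apply: cvgD; [exact: prim_continuous|exact: cvg_id]. Qed.

(** [P] stays within the distance [C] of the identity, so the intermediate value theorem applies
    between y - C and y + C. *)
Lemma primD1_surj y : exists x, P x = y.
Proof.
pose C := \int[mu]_x `|u x - 1|.
have HC t : `|prim (fun x => u x - 1) t| <= C.
  apply: le_trans (le_normr_Rintegral _ _) _ => //; first exact: integrableS iu.
  rewrite Rintegral_mkcond; apply: le_Rintegral => //.
  - by apply: integrable_patch => //; exact: integrable_norm iu.
  - exact: integrable_norm iu.
  - by move=> x _; rewrite patchE; case: ifP => // _; exact: normr_ge0.
have C0 : 0 <= C by exact: le_trans (HC 0).
have [] := @IVT R P (y - C) (y + C) y; first lra.
- by apply: continuous_subspaceT; exact: P_continuous.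
- have := HC (y - C); have := HC (y + C).
  rewrite !ler_norml => /andP[h1 h2] /andP[h3 h4].
  by rewrite ge_min le_max /P; apply/andP; split; apply/orP; [left|right]; lra.
by move=> x _ <-; exists x.
Qed.

Definition density_measure (A : set (measurableTypeR R)) : \bar R :=
  (\int[mu]_(x in A) (u x)%:E)%E.

Let dm0 : density_measure set0 = 0%E. Proof. exact: integral_set0. Qed.

Let dm_ge0 A : (0 <= density_measure A)%E.
Proof. by apply: integral_ge0 => x _; rewrite lee_fin. Qed.

Let dm_sigma_additive : semi_sigma_additive density_measure.
Proof.
apply: semi_sigma_additive_nng_induced; first exact/measurable_EFinP.
by move=> x; rewrite lee_fin.
Qed.

HB.instance Definition _ := isMeasure.Build _ _ _ density_measure
  dm0 dm_ge0 dm_sigma_additive.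

(** The image under [P] of the measure with density [u] gives every interval ]a, b] its length,
    hence is Lebesgue measure; the formula then follows from the change of variables for image
    measures. *)
Lemma ge0_integral_substitution (psi : R -> R) (H : R -> \bar R) :
  cancel P psi -> cancel psi P -> continuous psi ->
  (forall a b, (psi a < psi b) = (a < b)) ->
  measurable_fun setT H -> (forall x, 0 <= H x)%E ->
  (\int[mu]_y H (psi y) = \int[mu]_x (H x * (u x)%:E))%E.
Proof.
move=> Pp pP cpsi psi_lt mH H0.
have mP : measurable_fun [set: measurableTypeR R] (P : _ -> measurableTypeR R).
  exact: continuous_measurable_fun P_continuous.
have mpsi : measurable_fun [set: measurableTypeR R] (psi : _ -> measurableTypeR R).
  exact: continuous_measurable_fun cpsi.
pose nu : {measure set (measurableTypeR R) -> \bar R} :=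
  @measure_function_pushforward__canonical__measure_function_Measure
    _ _ _ _ _ density_measure _ mP.
have E A : measurable A -> mu A = nu A.
  apply: lebesgue_measure_unique => _ [[a b]] _ <-.
  change (mu `]a, b]%classic = density_measure (P @^-1` `]a, b])).
  have psi_le x y : (psi x <= psi y) = (x <= y) by rewrite !leNgt psi_lt.
  rewrite (_ : P @^-1` `]a, b] = `]psi a, psi b]%classic); last first.
    have e1 x : (psi a < x) = (a < P x) by rewrite -{1}(Pp x) psi_lt.
    have e2 x : (x <= psi b) = (P x <= b) by rewrite -{1}(Pp x) psi_le.
    by apply/seteqP; split=> x /=; rewrite !in_itv/= e1 e2.
  rewrite lebesgue_measure_itv/= lte_fin; case: ltP => [ab|ba].
    rewrite /density_measure integral_itv_obnd_cbnd; last first.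
      by apply/measurable_EFinP; exact: measurable_funTS.
    by rewrite -primD1E ?psi_le ?(ltW ab)// -/(P _) -/(P (psi a)) !pP -EFinD.
  by rewrite set_itv_ge// bnd_simp psi_lt -leNgt.
rewrite -(ge0_integral_density (nu := density_measure))//.
rewrite -(ge0_integral_pushforward mpsi _ measurableT)//.
apply: eq_measure_integral => A mA _.
have mA' : measurable (psi @^-1` A) by rewrite -[X in measurable X]setTI; exact: mpsi.
change (mu (psi @^-1` A) = density_measure A); rewrite (E _ mA').
change (density_measure (P @^-1` (psi @^-1` A)) = density_measure A).
by congr density_measure; apply/seteqP; split => x /=; rewrite Pp.
Qed.

End substitution.

(** * Curves as functions on the line, and their metric derivative *)

Section curve_basics.
Context {R : realType}.
Local Notation mu := (@lebesgue_measure R).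

Lemma val_clip (t : R) : 0 <= t <= 1 -> val (clip t) = t.
Proof.
by move=> /andP[t0 t1]; rewrite /= min_r// max_r.
Qed.

Lemma clip_val (t : I01 R) : clip (val t) = t.
Proof.
apply: val_inj; rewrite val_clip//.
by have := valP t; rewrite inE/= /I01/= in_itv.
Qed.

Lemma I01_itv (t : I01 R) : 0 <= val t <= 1.
Proof. by have := valP t; rewrite inE/= /I01/= in_itv. Qed.

Lemma clip_le (a b : R) : a <= b -> val (clip a) <= val (clip b).
Proof.
move=> ab /=; rewrite ge_max le_max lexx/=.
by rewrite le_max le_min !ge_min lexx/= ab !orbT.
Qed.

Lemma clip_itv_sub (a b : R) : `]val (clip a), val (clip b)] `<=` `]a, b] `&` I01 R.
Proof.
move=> x /=; rewrite in_itv/= gt_max gt_min le_max le_min.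
move=> /andP[/andP[x0 ax] /orP[|/andP[x1 xb]]]; first by rewrite leNgt x0.
split; rewrite /I01/= in_itv/= ?x1 ?xb ?(ltW x0)// andbT.
by case/orP: ax => //; rewrite ltNge x1.
Qed.

Lemma val_continuous : continuous (set_val : I01 R -> R).
Proof. exact: initial_continuous. Qed.

Lemma comp_val_continuous (T : topologicalType) (c : R -> T) :
  continuous c -> continuous (fun t : I01 R => c (set_val t)).
Proof.
by move=> cc t; apply: continuous_comp; [exact: val_continuous|exact: cc].
Qed.

Definition curve_of (T : topologicalType) (c : R -> T) (cc : continuous c) : C01 R T :=
  Continuous.pack_ (isContinuous.Build _ _ _ (comp_val_continuous cc)).

Lemma ae01P (Q : R -> Prop) :
  (\forall t \ae mu, Q t) -> ae01 Q.
Proof. by apply: negligibleS => t /= nQ Qt; apply: nQ => _. Qed.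

Lemma ae01I (Q1 Q2 : R -> Prop) : ae01 Q1 -> ae01 Q2 -> ae01 (fun t => Q1 t /\ Q2 t).
Proof.
move=> H1 H2; apply: negligibleS (negligibleU H1 H2) => t nQ.
apply: contrapT => /not_orP[/contrapT h1 /contrapT h2]; apply: nQ => t01.
by split; [exact: h1|exact: h2].
Qed.

Lemma ae01_imp (Q1 Q2 : R -> Prop) : (forall t, 0 < t < 1 -> Q1 t -> Q2 t) ->
  ae01 Q1 -> ae01 Q2.
Proof.
by move=> Q12; apply: negligibleS => t /= nQ Qt; apply: nQ => t01; exact/Q12/Qt.
Qed.

Lemma ae01_I01 (Q : R -> Prop) : ae01 Q -> \forall t \ae mu, I01 R t -> Q t.
Proof.
have n1 (r : R) : mu.-negligible [set r].
  by exists [set r]; split=> //; exact: lebesgue_measure_set1.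
move=> nQ; apply: negligibleS (negligibleU nQ (negligibleU (n1 0) (n1 1))).
move=> t /= /not_implyP[]; rewrite /I01/= in_itv/= => /andP[t0 t1] Qt.
have [->|tn0] := eqVneq t 0; first by right; left.
have [->|tn1] := eqVneq t 1; first by right; right.
by left; apply: contra_not Qt; apply; rewrite !lt_neqAle eq_sym tn0 tn1 t0.
Qed.

End curve_basics.

Section curve_metric.
Context {R : realType} {X : completeMetricType R}.
Local Notation mu := (@lebesgue_measure R).
Implicit Types g : C01 R X.

Lemma ext_val g (t : I01 R) : ext g (val t) = g t.
Proof. by rewrite /ext/= clip_val. Qed.

(** The bound |v| on [0,1], extended by 0, dominates the distances along [ext g] on the whole line,
    because [clip] maps intervals into their traces on [0,1]. So the abstract theorem applies, and
    its density agrees with [mderiv g] wherever the limit exists. *)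
Lemma abs_cont_mderiv g : abs_cont g ->
  [/\ mu.-integrable setT (EFin \o mderiv g),
      forall a b, a <= b ->
        mdist (ext g a : X) (ext g b) <= prim (mderiv g) b - prim (mderiv g) a &
      \forall t \ae mu, diff_quot g t h @[h --> 0^'] --> mderiv g t].
Proof.
move=> [v iv gv].
pose V := (fun r => `|v r|) \_ (I01 R).
have mI := @measurable_I01 R.
have iV : mu.-integrable setT (EFin \o V).
  rewrite /V -restrict_EFin.
  have iv' : mu.-integrable (I01 R) (EFin \o (fun r => `|v r|)) by exact: integrable_norm.
  exact: (proj1 (integrable_mkcond _ _)).
have V0 x : 0 <= V x by rewrite /V patchE; case: ifP.
pose d a b := mdist (ext g a : X) (ext g b).
have dV a b : a <= b -> d a b <= prim V b - prim V a.
  move=> ab; rewrite -lee_fin EFin_primB//.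
  apply: le_trans (gv (clip a) (clip b) (clip_le ab)) _.
  have sub : `]val (clip a), val (clip b)] `<=` I01 R.
    by move=> x /clip_itv_sub[].
  have mv : measurable_fun (I01 R) (EFin \o v) by exact: (measurable_int mu).
  rewrite -integral_itv_obnd_cbnd; last exact: measurable_funS mv.
  apply: le_trans (lee_abs _) _.
  apply: le_trans (le_abse_integral _ _ _) _ => //; first exact: measurable_funS mv.
  have mV : measurable_fun setT (EFin \o V) by exact: (measurable_int mu).
  have -> : (\int[mu]_(x in `]val (clip a), val (clip b)]) `|(EFin \o v) x| =
      \int[mu]_(x in `]val (clip a), val (clip b)]) (EFin \o V) x)%E.
    apply: eq_integral => x /[!inE] xab.
    by rewrite /= /V patchE mem_set//; exact: sub.
  rewrite -integral_itv_obnd_cbnd; last exact: measurable_funTS.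
  apply: ge0_subset_integral => //.
  - exact: measurable_funTS.
  - by move=> x _; rewrite lee_fin.
  - by move=> x /clip_itv_sub[].
have [l [il _ dl cvl]] : exists l : R -> R,
  [/\ mu.-integrable setT (EFin \o l), forall x, 0 <= l x,
      forall a b, a <= b -> d a b <= prim l b - prim l a &
      \forall t \ae mu, d t (t + h) / `|h| @[h --> 0^'] --> l t].
  apply: metric_derivative iV V0 dV => //.
  - by move=> a; exact: mdistxx.
  - by move=> a b; exact: metric_sym.
  - by move=> a b; exact: mdist_ge0.
  - by move=> a b c; exact: metric_triangle.
have lm : ae_eq mu setT (EFin \o l) (EFin \o mderiv g).
  apply: negligibleS cvl => t /=; apply: contra_not => ct _.
  by congr EFin; apply/esym/cvg_lim.
have mm := @measurable_mderiv R X g.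
have im : mu.-integrable setT (EFin \o mderiv g).
  apply/integrableP; split; first exact/measurable_EFinP.
  have /integrableP[_] := il; apply: le_lt_trans.
  apply: ae_ge0_le_integral => //.
  - by apply: measurableT_comp => //; exact/measurable_EFinP.
  - by apply: measurableT_comp => //; exact: (measurable_int mu).
  by apply: negligibleS lm => t /=; apply: contra_not => /(_ I) + _ => [= ->].
split=> //.
  move=> a b ab; apply: le_trans (dl _ _ ab) _.
  rewrite -lee_fin !EFin_primB// le_eqVlt; apply/orP; left; apply/eqP.
  apply: ae_eq_integral => //.
  - apply: measurable_funTS; exact: (measurable_int mu).
  - by apply: measurable_funTS; exact/measurable_EFinP.
  - by apply: negligibleS lm => t /=; apply: contra_not => + _ => /(_ I).
apply: negligibleS cvl => t /=; apply: contra_not => ct.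
by rewrite /mderiv (cvg_lim _ ct).
Qed.

End curve_metric.

(** * Changes of time with a prescribed density *)

Section reparametrization.
Context {R : realType}.
Local Notation mu := (@lebesgue_measure R).

(* [P] is the primitive of [w] on [0,1], continued with slope 1 on both sides so
   that it is a homeomorphism of the line. *)
Lemma reparametrization (w : R -> R) :
  mu.-integrable (I01 R) (EFin \o w) -> (forall t, 0 <= w t) ->
  ae01 (fun t => 0 < w t) -> (\int[mu]_(t in I01 R) (w t)%:E = 1)%E ->
  exists P psi : R -> R, [/\
    [/\ cancel P psi, cancel psi P, continuous P & continuous psi],
    [/\ P 0 = 0, P 1 = 1, (forall a b, (P a < P b) = (a < b)) &
        (forall a b, (psi a < psi b) = (a < b))],
    forall a b, 0 <= a -> a <= b -> b <= 1 ->
      ((P b - P a)%:E = \int[mu]_(t in `[a, b]) (w t)%:E)%E,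
    forall H : R -> \bar R, measurable_fun setT H -> (forall x, 0 <= H x)%E ->
      (\int[mu]_(y in I01 R) H (psi y) = \int[mu]_(x in I01 R) (H x * (w x)%:E))%E &
    ae01 (fun t => (P (t + h) - P t) / h @[h --> 0^'] --> w t)].
Proof.
move=> iw w0 w_gt0 w1.
have mI : measurable (I01 R : set (measurableTypeR R)) := @measurable_I01 R.
pose u t := if t \in I01 R then w t else 1.
pose U := (fun t => w t - 1) \_ (I01 R).
have UE : (fun t => u t - 1) = U.
  by apply/funext => t; rewrite /U /u patchE; case: ifP => // _; rewrite subrr.
have i1 : mu.-integrable (I01 R) (EFin \o cst 1).
  apply: continuous_compact_integrable; first exact: segment_compact.
  by apply: continuous_subspaceT => x; exact: cst_continuous.
have iU' : mu.-integrable (I01 R) (EFin \o (fun t => w t - 1)).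
  by apply: eq_integrable (integrableB mI iw i1).
have iU : mu.-integrable setT (EFin \o (fun t => u t - 1)).
  by rewrite UE /U -restrict_EFin; exact: (proj1 (integrable_mkcond _ _)).
have u0 t : 0 <= u t by rewrite /u; case: ifP.
have u_gt0 : \forall t \ae mu, 0 < u t.
  apply: negligibleS (ae01_I01 w_gt0) => t /= nt; apply/not_implyP.
  by move: nt; rewrite /u; case: ifPn => //; rewrite inE.
pose P t := prim (fun t => u t - 1) t + t.
have Plt a b : a < b -> P a < P b by exact: primD1_lt.
have Pc : continuous P by move=> t; apply: cvgD; [exact: prim_continuous|exact: cvg_id].
have [psi [Pp pP cpsi psi_lt]] := increasing_surj_inverse Plt (primD1_surj iU).
have P_le a b : a <= b -> P a <= P b.
  by rewrite le_eqVlt => /predU1P[->//|/Plt/ltW].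
have P_lt a b : (P a < P b) = (a < b).
  by apply/idP/idP; [apply: contraLR; rewrite -!leNgt; exact: P_le|exact: Plt].
have PE a b : 0 <= a -> a <= b -> b <= 1 ->
    ((P b - P a)%:E = \int[mu]_(t in `[a, b]) (w t)%:E)%E.
  move=> a0 ab b1; rewrite (primD1E iU ab).
  apply: eq_integral => t; rewrite inE/= in_itv/= => /andP[ta tb].
  rewrite /u mem_set// /I01/= in_itv/=.
  by rewrite (le_trans a0 ta) (le_trans tb b1).
have P0 : P 0 = 0.
  rewrite /P addr0 /prim -Rintegral_itv_bndo_bndc; last exact: integrableS iU.
  rewrite /Rintegral integral0_eq// => x; rewrite /= in_itv/= => x0.
  rewrite /u memNset ?subrr// /I01/= in_itv/= => /andP[].
  by rewrite leNgt x0.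
have P1 : P 1 = 1.
  have := PE 0 1 (lexx _) ler01 (lexx _).
  by rewrite P0 subr0 -/(I01 R) w1 => -[].
exists P, psi; split => //.
- move=> H mH H0.
  have psi0 : psi 0 = 0 by rewrite -{1}P0 Pp.
  have psi1 : psi 1 = 1 by rewrite -{1}P1 Pp.
  have psi_le a b : (psi a <= psi b) = (a <= b) by rewrite !leNgt psi_lt.
  have psiI y : (psi y \in I01 R) = (y \in I01 R).
    have e0 : (0 <= psi y) = (0 <= y) by rewrite -{1}psi0 psi_le.
    have e1 : (psi y <= 1) = (y <= 1) by rewrite -{1}psi1 psi_le.
    by apply/idP/idP; rewrite !inE /I01/= !in_itv/= e0 e1.
  have E : (fun y => H (psi y)) \_ (I01 R) = fun y => (H \_ (I01 R)) (psi y).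
    by apply/funext => y; rewrite !patchE psiI.
  rewrite [LHS]integral_mkcond [RHS]integral_mkcond E.
  rewrite (@ge0_integral_substitution R u iU u0 psi _ Pp pP cpsi psi_lt).
  + apply: eq_integral => t _; rewrite !patchE /u.
    by case: ifPn => // _; rewrite mul0e.
  + by apply/(measurable_restrictT _ mI); exact: measurable_funTS.
  + by move=> x; rewrite patchE; case: ifP.
- have H := ae01P (ae_lebesgue_pt iU).
  apply: ae01_imp H => t t01 /(lebesgue_pt_prim iU) ct.
  have -> : w t = u t - 1 + 1.
    rewrite subrK /u mem_set// /I01/= in_itv/=.
    by move: t01 => /andP[/ltW -> /ltW ->].
  have : (prim (fun t => u t - 1) (t + h) - prim (fun t => u t - 1) t) / h + 1 @[h --> 0^']
     --> u t - 1 + 1 by apply: cvgD => //; exact: cvg_cst.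
  apply: cvg_trans; apply: near_eq_cvg; near=> h.
  have h0 : h != 0 by near: h; exact: nbhs_dnbhs_neq.
  by rewrite /P; field.
Unshelve. all: by end_near. Qed.

End reparametrization.

(** * Gluing curves and the precise representative *)

Section occupation.
Context {R : realType} {X : completeMetricType R}.
Local Notation mu := (@lebesgue_measure R).

Lemma ge0_integral_leb01 (F : R -> \bar R) : measurable_fun setT F ->
  (forall t, 0 <= F t)%E ->
  (\int[leb01 R]_t F t = \int[mu]_(t in I01 R) F t)%E.
Proof.
move=> mF F0; have mI : measurable (I01 R : set (measurableTypeR R)) := @measurable_I01 R.
rewrite (@ge0_integral_density _ _ R (leb01 R) mu (\1_(I01 R)))//.
- rewrite [RHS]integral_mkcond; apply: eq_integral => t _.
  by rewrite patchE indicE; case: ifP; rewrite ?mule1 ?mule0.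
- by move=> A mA; rewrite /leb01/= /mrestr integral_indic// setIC.
Qed.

Lemma ge0_integral_M (g : C01 R X) (h : borel X -> \bar R) :
  measurable_fun setT h -> (forall x, 0 <= h x)%E ->
  (\int[M g]_x h x = \int[mu]_(t in I01 R) h (ext g t))%E.
Proof.
move=> mh h0.
have mhg : measurable_fun setT (h \o ext g) by exact: measurableT_comp (measurable_ext g).
rewrite -ge0_integral_leb01//.
by rewrite (ge0_integral_pushforward (measurable_ext g) (leb01 R) measurableT).
Qed.

End occupation.

Section ae_continuous.
Context {R : realType}.
Local Notation mu := (@lebesgue_measure R).

(** A difference at [t] persists on a nondegenerate interval inside ]a, b[. The end points are
    included because the gluing time 1/2 is one. *)
Lemma ae_eq_continuous (F G : R -> R) (a b : R) : continuous F -> continuous G ->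
  a < b -> (\forall t \ae mu, a < t < b -> F t = G t) ->
  forall t, a <= t <= b -> F t = G t.
Proof.
move=> cF cG ab [N [mN N0 NP]] t /andP[ta tb].
apply: contrapT => FGt.
have : \forall s \near t, 0 < `|F s - G s|.
  have : `|F s - G s| @[s --> t] --> `|F t - G t|.
    by apply: cvg_norm; apply: cvgB; [exact: cF|exact: cG].
  by move=> /cvgr_gt; apply; rewrite normr_gt0 subr_eq0; exact/eqP.
move=> /nbhs_ballP[e /= e0 eP].
pose l := Num.max a (t - e); pose r := Num.min b (t + e).
have lr : l < r.
  by rewrite /l /r gt_max !lt_min ab/=; apply/and3P; split; lra.
have : (mu `]l, r[%classic <= mu N)%E.
  apply: le_measure; rewrite ?inE// => s; rewrite /= in_itv/= /l /r gt_max lt_min.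
  move=> /andP[/andP[as_ ts] /andP[sb st]]; apply: NP => /= H.
  have := eP s; rewrite /ball/= distrC ltr_norml => /(_ _).
  rewrite H ?as_ ?sb// subrr normr0 ltxx => K; suff: false by [].
  by apply: K; apply/andP; split; lra.
by rewrite [leRHS]N0 lebesgue_measure_itv/= lte_fin lr -EFinD lee_fin; lra.
Qed.

Lemma lebesgue_measure_isometry (s c : R) (A : set R) : s = 1 \/ s = -1 ->
  measurable A -> mu ((fun r => s * r + c) @^-1` A) = mu A.
Proof.
move=> s1 mA.
have cphi : continuous (fun r : R => s * r + c).
  by move=> r; apply: cvgD; [apply: cvgMr; exact: cvg_id|exact: cvg_cst].
have mphi : measurable_fun [set: measurableTypeR R] ((fun r => s * r + c) : _ -> measurableTypeR R).
  exact: continuous_measurable_fun.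
pose nu : {measure set (measurableTypeR R) -> \bar R} :=
  @measure_function_pushforward__canonical__measure_function_Measure
    _ _ _ _ _ mu _ mphi.
symmetry; apply: (@lebesgue_measure_unique R nu) => // _ [[a b]] _ <-.
change (mu `]a, b]%classic = mu ((fun r => s * r + c) @^-1` `]a, b])).
case: s1 => ->.
  rewrite (_ : _ @^-1` _ = `](a - c), (b - c)]%classic); last first.
    by apply/seteqP; split => r /=; rewrite !in_itv/= => /andP[? ?]; apply/andP; split; lra.
  by rewrite !lebesgue_measure_itv/= !lte_fin ltrD2r opprB -!EFinD addrA subrK.
rewrite (_ : _ @^-1` _ = `[(c - b), (c - a)[%classic); last first.
  by apply/seteqP; split => r /=; rewrite !in_itv/= => /andP[? ?]; apply/andP; split; lra.
rewrite !lebesgue_measure_itv/= !lte_fin ltrD2l ltrN2 opprB -!EFinD.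
by case: ifP => // _; congr EFin; lra.
Qed.

Lemma ge0_integral_isometry (s c : R) (F : R -> \bar R) : s = 1 \/ s = -1 ->
  measurable_fun setT F -> (forall t, 0 <= F t)%E ->
  (\int[mu]_r F (s * r + c)%R = \int[mu]_r F r)%E.
Proof.
move=> s1 mF F0.
have cphi : continuous (fun r : R => s * r + c).
  by move=> r; apply: cvgD; [apply: cvgMr; exact: cvg_id|exact: cvg_cst].
have mphi : measurable_fun [set: measurableTypeR R] ((fun r => s * r + c) : _ -> measurableTypeR R).
  exact: continuous_measurable_fun.
have E1 := ge0_integral_pushforward mphi mu measurableT mF (fun y _ => F0 y).
apply: etrans (esym E1) _; apply: eq_measure_integral => A mA _; exact: lebesgue_measure_isometry.
Qed.

Lemma ae_isometry (s c : R) (Q : R -> Prop) : s = 1 \/ s = -1 ->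
  (\forall t \ae mu, Q t) -> \forall r \ae mu, Q (s * r + c).
Proof.
move=> s1 [N [mN N0 NP]]; exists ((fun r => s * r + c) @^-1` N); split.
- rewrite -[X in measurable X]setTI.
  have cphi : continuous (fun r : R => s * r + c).
    by move=> r; apply: cvgD; [apply: cvgMr; exact: cvg_id|exact: cvg_cst].
  exact: (continuous_measurable_fun cphi).
- by rewrite lebesgue_measure_isometry.
- by move=> r /= nQ; exact: NP.
Qed.

End ae_continuous.

Section gluing.
Context {R : realType} {X : completeMetricType R}.
Local Notation mu := (@lebesgue_measure R).
Variables (f : X -> R) (h : borel X -> \bar R).
Hypotheses (mh : measurable_fun setT h) (h0 : forall x, (0 <= h x)%E).

(* From any time one can move for a duration 1/2 at unit speed, in at least one
   direction, without leaving [0,1]. *)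
Let half_step (t : R) : R := if t <= 2^-1 then 1 else -1.

Let half_step1 t : half_step t = 1 \/ half_step t = -1.
Proof. by rewrite /half_step; case: ifP => _; [left|right]. Qed.

Let half_step_itv t r : 0 <= t <= 1 -> 0 < r < 2^-1 -> 0 < t + half_step t * r < 1.
Proof.
move=> /andP[t0 t1] /andP[r0 r1]; rewrite /half_step.
by case: (leP t) => t2; rewrite ?mul1r ?mulN1r; apply/andP; split; lra.
Qed.

Let half_step_itvcc t r : 0 <= t <= 1 -> 0 <= r <= 2^-1 -> 0 <= t + half_step t * r <= 1.
Proof.
move=> /andP[t0 t1] /andP[r0 r1]; rewrite /half_step.
by case: (leP t) => t2; rewrite ?mul1r ?mulN1r; apply/andP; split; lra.
Qed.

Let I01_halves : I01 R = `[0, 2^-1]%classic `|` `]2^-1, 1]%classic.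
Proof.
apply/seteqP; split=> r /=; rewrite /I01/= !in_itv/=.
  by move=> /andP[-> ->]; rewrite andbT/=; apply/orP; case: leP.
by move=> [|] /andP[? ?]; apply/andP; split; lra.
Qed.

Let half_gt0 : 0 < 2^-1 :> R. Proof. by []. Qed.

Let half_lt1 : 2^-1 < 1 :> R. Proof. lra. Qed.

Let half_le1 : 2^-1 <= 1 :> R. Proof. exact: ltW. Qed.

Lemma lipschitz_ext (g : C01 R X) : lipschitz_curve g ->
  exists2 L, 0 <= L & forall s t, mdist (ext g s : X) (ext g t) <= L * `|s - t|.
Proof.
move=> [L gL]; exists `|L| => // s t; rewrite /ext/=.
apply: le_trans (gL _ _) _; apply: le_trans (ler_norm _) _.
rewrite normrM normr_id ler_wpM2l//.
wlog : s t / s <= t.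
  move=> H; have [st|/ltW ts] := leP s t; first exact: H.
  by rewrite distrC [leRHS]distrC H.
move=> st; have := clip_le st; rewrite distrC (distrC s) => cst.
rewrite !ger0_norm ?subr_ge0//=.
rewrite /Num.max /Num.min; do ! case: ifP => //; move=> *; lra.
Qed.

Let max0_lip (u v : R) : `|Num.max 0 u - Num.max 0 v| <= `|u - v|.
Proof.
rewrite /Num.max; case: (ltP 0 u) => u0; case: (ltP 0 v) => v0 //.
- by rewrite subr0 ger0_norm ?(ltW u0)// ger0_norm; lra.
- by rewrite sub0r normrN ger0_norm ?(ltW v0)// ler0_norm; lra.
- by rewrite subrr normr0.
Qed.

(** The glued curve arrives along [g1] at the common point at time 1/2 and leaves it along [g2]. Its
    own continuous representative has a single value at time 1/2, which is both [f1 t1] and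
    [f2 t2]. *)
Lemma glue_reps (g1 g2 : C01 R X) (f1 f2 : C01 R R) (t1 t2 : I01 R) :
  (forall g, lipschitz_curve g -> (\int[M g]_x h x < +oo)%E -> Gamma f g) ->
  lipschitz_curve g1 -> lipschitz_curve g2 ->
  (\int[M g1]_x h x < +oo)%E -> (\int[M g2]_x h x < +oo)%E ->
  continuous_rep f g1 f1 -> continuous_rep f g2 f2 ->
  g1 t1 = g2 t2 -> f1 t1 = f2 t2.
Proof.
move=> HG L1 L2 h1 h2 r1 r2 g12.
pose x : X := g1 t1.
pose phi (t : I01 R) r := val t + half_step (val t) * r.
(* [Num.max 0] freezes [a] at [x] on the second half and [b] on the first, so that both are
   Lipschitz on the whole line. *)
pose a r : X := ext g1 (phi t1 (Num.max 0 (2^-1 - r))).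
pose b r : X := ext g2 (phi t2 (Num.max 0 (r - 2^-1))).
have phi0 t : phi t 0 = val t by rewrite /phi mulr0 addr0.
have aE r : 2^-1 <= r -> a r = x.
  by move=> hr; rewrite /a max_l ?phi0 ?ext_val// subr_le0.
have bE r : r <= 2^-1 -> b r = x.
  by move=> hr; rewrite /b max_l ?phi0 ?ext_val ?/x ?g12// subr_le0.
pose c r := if r <= 2^-1 then a r else b r.
have phi_lip t u v : `|phi t u - phi t v| = `|u - v|.
  rewrite /phi opprD addrACA subrr add0r -mulrBr normrM.
  by case: (half_step1 (val t)) => ->; rewrite ?normrN1 ?normr1 mul1r.
have [A A0 aL] : exists2 A, 0 <= A & forall r s, mdist (a r) (a s) <= A * `|r - s|.
  have [A A0 AL] := lipschitz_ext L1; exists A => // r s.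
  apply: le_trans (AL _ _) _; rewrite ler_wpM2l// phi_lip.
  have E : (2^-1 - r) - (2^-1 - s) = s - r by ring.
  by have := max0_lip (2^-1 - r) (2^-1 - s); rewrite E (distrC s).
have [B B0 bL] : exists2 B, 0 <= B & forall r s, mdist (b r) (b s) <= B * `|r - s|.
  have [B B0 BL] := lipschitz_ext L2; exists B => // r s.
  apply: le_trans (BL _ _) _; rewrite ler_wpM2l// phi_lip.
  have E : (r - 2^-1) - (s - 2^-1) = r - s by ring.
  by have := max0_lip (r - 2^-1) (s - 2^-1); rewrite E.
(* Times in different halves are compared through [x], where the other piece is at rest; hence the
   Lipschitz constants simply add. *)
have cd r s : mdist (c r) (c s) <= mdist (a r) (a s) + mdist (b r) (b s).
  rewrite /c; case: ifPn => [rle|]; case: ifPn => [sle|].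
  - by rewrite lerDl mdist_ge0.
  - rewrite -ltNge => /ltW sge; rewrite (aE s sge) (bE r rle); exact: metric_triangle.
  - rewrite -ltNge => /ltW rge; rewrite (aE r rge) (bE s sle) addrC.
    exact: metric_triangle.
  - by rewrite lerDr mdist_ge0.
have cL r s : mdist (c r) (c s) <= (A + B) * `|r - s|.
  by apply: le_trans (cd r s) _; rewrite mulrDl lerD.
have AB0 : 0 <= A + B by rewrite addr_ge0.
have cc : continuous (c : R -> X).
  move=> r; apply/metricType_numDomainType.cvgrPdist_lt => e e0; near=> s.
  apply: le_lt_trans (cL r s) _.
  apply: (@le_lt_trans _ _ ((A + B + 1) * `|r - s|)); first by rewrite ler_wpM2r// lerDl.
  rewrite mulrC -ltr_pdivlMr ?ltr_wpDl//.
  by near: s; apply: cvgr_dist_lt; rewrite ?divr_gt0 ?ltr_wpDl.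
have [g gE0] : exists g : C01 R X, forall t, g t = c (val t) by exists (curve_of cc).
have gE r : 0 <= r <= 1 -> ext g r = c r.
  by move=> r01; rewrite /ext/= gE0 val_clip.
have gL : lipschitz_curve g by exists (A + B) => s t; rewrite !gE0.
have hE (g' : C01 R X) := ge0_integral_M g' mh h0.
have mI : measurable (I01 R : set (measurableTypeR R)) := @measurable_I01 R.
have mhg (g' : C01 R X) : measurable_fun setT (fun t => h (ext g' t)).
  exact: (measurableT_comp mh (measurable_ext g')).
have maff (g' : C01 R X) (s k : R) : measurable_fun setT (fun r : R => h (ext g' (s * r + k))).
  apply: (measurableT_comp (mhg g')); apply: continuous_measurable_fun.
  by move=> r; apply: cvgD; [apply: cvgMr; exact: cvg_id|exact: cvg_cst].
(* The two pieces in affine form: at time [r] the glued curve is at [g1] of time s1 r + k1 on the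
   first half and at [g2] of time s2 r + k2 on the second, with slopes 1 or -1. *)
pose s1 := - half_step (val t1); pose k1 := val t1 + half_step (val t1) / 2.
pose s2 := half_step (val t2); pose k2 := val t2 - half_step (val t2) / 2.
have s11 : s1 = 1 \/ s1 = -1.
  by rewrite /s1; case: (half_step1 (val t1)) => ->; [right|left; rewrite opprK].
have s21 : s2 = 1 \/ s2 = -1 := half_step1 _.
have phi1 r : s1 * r + k1 = phi t1 (2^-1 - r) by rewrite /s1 /k1 /phi; ring.
have phi2 r : s2 * r + k2 = phi t2 (r - 2^-1) by rewrite /s2 /k2 /phi; ring.
have k1P' r : 0 < r < 2^-1 -> 0 < s1 * r + k1 < 1.
  move=> /andP[r0' r1']; rewrite phi1; apply: half_step_itv; first exact: I01_itv.
  by apply/andP; split; lra.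
have k2P' r : 2^-1 < r < 1 -> 0 < s2 * r + k2 < 1.
  move=> /andP[r0' r1']; rewrite phi2; apply: half_step_itv; first exact: I01_itv.
  by apply/andP; split; lra.
have phiP (t : I01 R) r : 0 <= r <= 2^-1 -> 0 <= phi t r <= 1.
  by apply: half_step_itvcc; exact: I01_itv.
have k1P r : 0 <= r <= 2^-1 -> 0 <= s1 * r + k1 <= 1.
  by move=> /andP[r0' r1']; rewrite phi1; apply: phiP; apply/andP; split; lra.
have k2P r : 2^-1 <= r <= 1 -> 0 <= s2 * r + k2 <= 1.
  by move=> /andP[r0' r1']; rewrite phi2; apply: phiP; apply/andP; split; lra.
have gE1 r : 0 <= r <= 2^-1 -> ext g r = ext g1 (s1 * r + k1).
  move=> /andP[r0' r1']; rewrite gE ?r0'/=; last by lra.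
  by rewrite /c r1' /a max_r ?phi1// subr_ge0.
have gE2 r : 2^-1 <= r <= 1 -> ext g r = ext g2 (s2 * r + k2).
  move=> /andP[r0' r1']; rewrite gE ?r1'/= ?andbT; last by lra.
  have [r2'|r2'] := eqVneq r 2^-1.
    by rewrite /c r2' lexx aE// phi2 subrr phi0 ext_val.
  by rewrite /c leNgt lt_neqAle eq_sym r2' r0'/= /b max_r ?phi2// subr_ge0.
have maffI (g' : C01 R X) (s k : R) : measurable_fun setT
    (fun r : R => ((fun t => h (ext g' t)) \_ (I01 R)) (s * r + k)).
  apply: (measurableT_comp (f := (fun t => h (ext g' t)) \_ (I01 R))).
    by apply/(measurable_restrictT _ mI); exact: measurable_funTS.
  apply: continuous_measurable_fun => r.
  by apply: cvgD; [apply: cvgMr; exact: cvg_id|exact: cvg_cst].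
(* With the integrand extended by 0 outside [0,1], the isometry of the line preserves the whole
   integral along [g'], and the piece contributes only part of it. *)
have piece (g' : C01 R X) (s k : R) (J : set R) :
    (\int[M g']_x h x < +oo)%E -> (s = 1 \/ s = -1) -> measurable (J : set (measurableTypeR R)) ->
    (forall r, J r -> 0 <= s * r + k <= 1) ->
    (\int[mu]_(r in J) h (ext g' (s * r + k)%R) < +oo)%E.
  rewrite hE => hfin ss mJ JP; apply: le_lt_trans hfin.
  rewrite [leRHS]integral_mkcond -(@ge0_integral_isometry _ s k)//; last 2 first.
  - by apply/(measurable_restrictT _ mI); exact: measurable_funTS.
  - by move=> r; rewrite patchE; case: ifP.
  rewrite [leLHS]integral_mkcond; apply: ge0_le_integral => //.
  - by move=> r _; rewrite patchE; case: ifP.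
  - by apply/(measurable_restrictT _ mJ); apply: measurable_funTS; exact: maff.
  - by apply/measurable_funTS; exact: maffI.
  - move=> r _; rewrite !patchE; case: ifPn => [|_]; last by case: ifP.
    by rewrite inE => /JP skr; rewrite mem_set// /I01/= in_itv.
have gh : (\int[M g]_x h x < +oo)%E.
  rewrite hE.
  rewrite I01_halves ge0_integral_setU//; last 2 first.
  - exact: measurable_funTS.
  - rewrite disj_set2E; apply/eqP; apply/seteqP; split=> // r /=.
    by rewrite !in_itv/= => -[/andP[_ +] /andP[+ _]]; case: leP.
  rewrite lte_add_pinfty//.
    rewrite (_ : (\int[mu]_(r in _) _ = \int[mu]_(r in `[0%R, 2^-1%R])
       h (ext g1 (s1 * r + k1)%R))%E); last first.
      apply: eq_integral => r; rewrite inE/= in_itv/= => /andP[r0' r1'].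
      by rewrite gE1// r0'.
    exact: piece.
  rewrite (_ : (\int[mu]_(r in _) _ = \int[mu]_(r in `]2^-1%R, 1%R])
       h (ext g2 (s2 * r + k2)%R))%E); last first.
    apply: eq_integral => r; rewrite inE/= in_itv/= => /andP[r0' r1'].
    by rewrite gE2// r1' ltW.
  apply: piece => // r; rewrite /= in_itv/= => /andP[r0' r1'].
  by apply: k2P; rewrite r1' ltW.
have [_ [fg rg]] := HG g gL gh.
have cclip (f' : C01 R R) : continuous (fun r => f' (clip r) : R).
  by move=> r; apply: (@continuous_comp _ _ _ (@clip R) f'); [exact: clip_continuous|exact: cts_fun].
(* Both sides represent [f] along the same piece, hence agree almost everywhere on ]u, v[;
   continuity extends this to the closed interval and thus to time 1/2. *)
have rep_piece (g' : C01 R X) (f' : C01 R R) (s k u v : R) :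
    continuous_rep f g' f' -> (s = 1 \/ s = -1) -> 0 <= u -> u < v -> v <= 1 ->
    (forall r, u < r < v -> 0 < s * r + k < 1 /\ ext g r = ext g' (s * r + k)) ->
    forall r, u <= r <= v -> fg (clip r) = f' (clip (s * r + k)).
  move=> r' s1' u0 uv v1 H; apply: ae_eq_continuous => //.
    move=> r; apply: (@continuous_comp _ _ _ (fun r => s * r + k) (fun r => f' (clip r))).
      by apply: cvgD; [apply: cvgMr; exact: cvg_id|exact: cvg_cst].
    exact: cclip.
  have := negligibleU rg (ae_isometry k s1' r'); apply: negligibleS => r nr.
  apply: contrapT => /not_orP[/contrapT H1 /contrapT H2]; apply: nr => ruv.
  have [skr er] := H r ruv.
  have /andP[ur rv] := ruv.
  rewrite /= in H1 H2; rewrite H1 ?(le_lt_trans u0 ur) ?(lt_le_trans rv v1)//.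
  by rewrite H2//; move: er; rewrite /ext/= => ->.
have E1 : fg (clip 2^-1) = f1 t1.
  rewrite (rep_piece g1 f1 s1 k1 0 2^-1 r1)//; last 2 first.
  - move=> r r01; split; first exact: k1P'.
    by apply: gE1; move: r01 => /andP[/ltW -> /ltW ->].
  - by rewrite lexx ?(ltW half_gt0) ?(ltW half_lt1).
  by rewrite (_ : s1 * 2^-1 + k1 = val t1) ?clip_val// /s1 /k1; lra.
have E2 : fg (clip 2^-1) = f2 t2.
  rewrite (rep_piece g2 f2 s2 k2 2^-1 1 r2)//; last 2 first.
  - move=> r r01; split; first exact: k2P'.
    by apply: gE2; move: r01 => /andP[/ltW -> /ltW ->].
  - by rewrite lexx ?(ltW half_gt0) ?(ltW half_lt1).
  by rewrite (_ : s2 * 2^-1 + k2 = val t2) ?clip_val// /s2 /k2; lra.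
by rewrite -E1 E2.
Unshelve. all: by end_near. Qed.
(** All values that continuous representatives along curves with finite integral of [h] propose at
    [x]. [glue_reps] leaves at most one of them. *)
Let rep_values (x : X) : set R := [set v | exists g fg t,
  [/\ lipschitz_curve g, (\int[M g]_y h y < +oo)%E, continuous_rep f g fg,
      g t = x & fg t = v]].

Definition precise_rep (x : X) : R := xget (f x) (rep_values x).

Lemma precise_rep_fin x :
  (forall g, lipschitz_curve g -> (\int[M g]_x h x < +oo)%E -> Gamma f g) ->
  (h x < +oo)%E -> precise_rep x = f x.
Proof.
move=> HG hx.
have [g gE] : exists g : C01 R X, forall t, g t = x.
  by exists (curve_of (fun t : R => @cst_continuous R X x t)).
have Lg : lipschitz_curve g by exists 0 => s t; rewrite !gE mdistxx mul0r.
have hg : (\int[M g]_y h y < +oo)%E.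
  rewrite ge0_integral_M//.
  under eq_integral do rewrite /ext/= gE.
  rewrite integral_cst//; last exact: measurable_I01.
  have := @lebesgue_measure_itv R `[0, 1]; rewrite /= lte_fin ltr01 oppr0 adde0 => ->.
  by rewrite mule1.
have rg : continuous_rep f g (curve_of (fun t : R => @cst_continuous R R (f x) t)).
  by exists set0; split=> // t /=; rewrite gE; apply.
have ex : exists v, rep_values x v.
  by exists (f x), g, (curve_of (fun t : R => @cst_continuous R R (f x) t)), (clip 0).
rewrite /precise_rep; have [g' [fg' [t' [Lg' hg' rg' gt' <-]]]] := xgetPex (f x) ex.
rewrite (glue_reps (t2 := clip 0) HG Lg' Lg hg' hg rg' rg)//.
by rewrite gE.
Qed.

Lemma precise_repE (g : C01 R X) :
  (forall g, lipschitz_curve g -> (\int[M g]_x h x < +oo)%E -> Gamma f g) ->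
  lipschitz_curve g -> (\int[M g]_x h x < +oo)%E -> equals_rep f precise_rep g.
Proof.
move=> HG Lg hg; have [_ [fg rg]] := HG g Lg hg; exists fg => // t.
have ex : exists v, rep_values (g t) v by exists (fg t), g, fg, t.
rewrite /precise_rep; have [g' [fg' [t' [Lg' hg' rg' gt' <-]]]] := xgetPex (f (g t)) ex.
exact: glue_reps HG Lg' Lg hg' hg rg' rg gt'.
Qed.

End gluing.

(** * Test plans *)

Section caratheodory.
Context {R : realType} d (T : measurableType d).

(** Rounds [t] down to a multiple of 1 / (n + 1): the rounded time takes countably many values, so
    measurability at each fixed time suffices for the discretized map. *)
Let fl (n : nat) (t : R) : R := (Num.floor (n.+1%:R * t))%:~R / n.+1%:R.

Let fl_cvg t : fl n t @[n --> \oo] --> t.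
Proof.
apply/cvgrPdist_lt => e e0.
have := near_infty_natSinv_lt (PosNum e0); apply: filterS => n /= ne.
have n0 : 0 < n.+1%:R :> R by [].
have [lo hi] := (floor_le_tmp (n.+1%:R * t), floorD1_gt (n.+1%:R * t)).
have : `|t - fl n t| * n.+1%:R <= 1.
  rewrite -[X in _ * X](gtr0_norm n0) -normrM mulrBl /fl divfK ?gt_eqF//.
  rewrite mulrC ger0_norm ?subr_ge0//.
  by move: hi; rewrite intrD; lra.
by rewrite -ler_pdivlMr// div1r => /le_lt_trans; apply.
Qed.

Let measurable_fl d' (U : measurableType d') (E : T -> R -> U) (n : nat) :
  (forall t, measurable_fun setT (E ^~ t)) ->
  measurable_fun setT (fun z : T * measurableTypeR R => E z.1 (fl n z.2)).
Proof.
move=> mE _ B mB; rewrite setTI.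
rewrite (_ : _ @^-1` B = \bigcup_(k : int) (((E ^~ (k%:~R / n.+1%:R)) @^-1` B) `*`
    [set t | Num.floor (n.+1%:R * t) = k])); last first.
  apply/seteqP; split=> [[x t] /= Bx|[x t] [k _ [/= + kt]]].
    by exists (Num.floor (n.+1%:R * t)).
  by rewrite /fl kt.
apply: countable_bigcupT_measurable => [|k]; first exact: countableP.
apply: measurableX; first by rewrite -[X in measurable X]setTI; exact: mE.
rewrite (_ : [set t | _] = `[k%:~R / n.+1%:R, (k + 1)%:~R / n.+1%:R[%classic); last first.
  apply/seteqP; split=> t /=; rewrite in_itv/= ler_pdivrMr// ltr_pdivlMr// mulrC.
    by move=> <-; rewrite floor_le_tmp floorD1_gt.
  by move=> /andP[kt tk]; apply/floor_def; rewrite kt.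
exact: measurable_itv.
Qed.

Lemma caratheodory_real (E : T -> R -> R) :
  (forall t, measurable_fun setT (E ^~ t)) -> (forall x, continuous (E x)) ->
  measurable_fun setT (fun z : T * measurableTypeR R => E z.1 z.2).
Proof.
move=> mE cE; apply: (@measurable_fun_cvg _ _ _ _ (fun n z => E z.1 (fl n z.2))).
  by move=> n; exact: measurable_fl.
move=> [x t] _ /=; apply: (@cvg_comp _ _ _ (fl ^~ t) (E x) _ (nbhs t)); first exact: fl_cvg.
exact: cE.
Qed.

(* The limit of the discretizations lies in the open set [U] if and only if they
   eventually stay at a distance at least 1/k from its complement. *)
Lemma caratheodory_metric (X : completeMetricType R) (E : T -> R -> borel X) :
  (forall t, measurable_fun setT (E ^~ t)) -> (forall x, continuous (E x : R -> X)) ->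
  measurable_fun setT (fun z : T * measurableTypeR R => E z.1 z.2).
Proof.
move=> mE cE.
apply: (@measurability _ _ _ (borel X) setT _ (@open X)) => // _ [U oU <-].
pose V k : set X := [set x | forall y, mdist x y < k.+1%:R^-1 -> U y].
have mV k : measurable (V k : set (borel X)).
  rewrite -[V k]setCK; apply: measurableC; apply: sub_sigma_algebra => /=.
  rewrite openE => x /= /existsNP[y /not_implyP[xy nUy]].
  have e0 : 0 < k.+1%:R^-1 - mdist x y by rewrite subr_gt0.
  apply/nbhs_ballP; exists (k.+1%:R^-1 - mdist x y) => // z.
  rewrite ballEmdist/= => xz Vz; apply: nUy; apply: Vz.
  have := metric_triangle z x y; rewrite (metric_sym z x) => zxy.
  by rewrite (le_lt_trans zxy)// -ltrBrDr.
rewrite setTI (_ : _ @^-1` U = \bigcup_k \bigcup_N \bigcap_n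
    ((fun z : T * measurableTypeR R => E z.1 (fl (N + n) z.2)) @^-1` V k)); last first.
  apply/seteqP; split=> [[x t] /= Ut|[x t] [k _ [N _ /= H]]].
    have /nbhs_ballP[e /= e0 eU] : nbhs (E x t : X) U by exact: open_nbhs_nbhs.
    have e2 : 0 < e / 2 by rewrite divr_gt0.
    have [k _ /(_ _ (leqnn k)) ke] := near_infty_natSinv_lt (PosNum e2).
    have : \forall n \near \oo, mdist (E x t : X) (E x (fl n t)) < e / 2.
      have : E x (fl n t) @[n --> \oo] --> (E x t : X).
        by apply: (@cvg_comp _ _ _ (fl ^~ t) (E x) _ (nbhs t)); [exact: fl_cvg|exact: cE].
      by move/metricType_numDomainType.cvgrPdist_lt; exact.
    move=> [N _ HN]; exists k => //; exists N => // n _ /= y yE; apply: eU.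
    rewrite ballEmdist/=; apply: le_lt_trans (metric_triangle _ (E x (fl (N + n) t)) _) _.
    rewrite [e]splitr; apply: ltrD; last exact: lt_trans yE ke.
    exact: (HN (N + n)%N (leq_addr _ _)).
  have : \forall n \near \oo, mdist (E x t : X) (E x (fl n t)) < k.+1%:R^-1.
    have : E x (fl n t) @[n --> \oo] --> (E x t : X).
      by apply: (@cvg_comp _ _ _ (fl ^~ t) (E x) _ (nbhs t)); [exact: fl_cvg|exact: cE].
    by move/metricType_numDomainType.cvgrPdist_lt; apply; rewrite invr_gt0.
  move=> [n _ Hn]; apply: (H n I); rewrite metric_sym.
  exact: (Hn (N + n)%N (leq_addl _ _)).
apply: bigcupT_measurable => k; apply: bigcupT_measurable => N.
apply: bigcapT_measurable => n; rewrite -[X in measurable X]setTI.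
by apply: measurable_fl.
Qed.

End caratheodory.

(** * Measurable functionals on the space of curves *)

Section evaluation.
Context {R : realType} {X : completeMetricType R}.

(** [B] consists of arbitrary maps, because the topology of [C01] is induced from uniform
    convergence on the space of all maps. *)
Lemma open_C01 (B : set (I01 R -> X)) :
  (forall k, B k -> exists2 e, 0 < e & forall k', (forall t, mdist (k t) (k' t) < e) -> B k') ->
  open [set g : C01 R X | B (g : _ -> _)].
Proof.
move=> HB; exists (B : set {uniform I01 R -> X}) => //.
rewrite openE => k Bk; have [e e0 He] := HB k Bk.
apply/uniform_nbhs; exists [set xy : X * X | ball xy.1 e xy.2]; split.
  exact: entourage_ball (PosNum e0).
move=> k' /= Hk'; apply: He => t.
by have := Hk' t I; rewrite ballEmdist.
Qed.

Lemma measurable_ext_eval (t : R) :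
  measurable_fun setT ((fun g => ext g t) : borel (C01 R X) -> borel X).
Proof.
apply: (@measurability _ _ _ (borel X) setT _ (@open X)) => // _ [U oU <-].
rewrite setTI; apply: sub_sigma_algebra => /=.
apply: (@open_C01 [set k | U (k (clip t))]) => k Uk.
have /nbhs_ballP[e /= e0 He] : nbhs (k (clip t)) U by exact: open_nbhs_nbhs.
by exists e => // k' Hk'; apply: He; rewrite ballEmdist; exact: Hk'.
Qed.

(** Superlevel sets are open for uniform convergence: moving every point of the curve by less than
    half the excess over [c] keeps the distance above [c]. This avoids measurability of the metric
    on a product of Borel spaces. *)
Lemma measurable_mdist_eval (s t : R) :
  measurable_fun setT ((fun g => mdist (ext g s : X) (ext g t)) : borel (C01 R X) -> R).
Proof.
apply: (measurability _ (RGenOInfty.measurableE R)) => // _ [_ [c ->] <-].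
rewrite setTI; apply: sub_sigma_algebra => /=.
rewrite (_ : _ @^-1` _ = [set g : C01 R X | c < mdist (g (clip s)) (g (clip t))]); last first.
  by apply/seteqP; split => g /=; rewrite in_itv/= andbT.
apply: (@open_C01 [set k | c < mdist (k (clip s)) (k (clip t))]) => k /= ck.
exists ((mdist (k (clip s)) (k (clip t)) - c) / 2).
  by rewrite divr_gt0// subr_gt0.
move=> k' Hk'; have := Hk' (clip s); have := Hk' (clip t).
have := metric_triangle (k (clip s)) (k' (clip s)) (k (clip t)).
have := metric_triangle (k' (clip s)) (k' (clip t)) (k (clip t)).
rewrite (metric_sym (k' (clip t)) (k (clip t))); lra.
Qed.

Lemma measurable_ext_joint : measurable_fun setT
  (fun z : borel (C01 R X) * measurableTypeR R => ext (z.1 : C01 R X) z.2).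
Proof.
apply: (@caratheodory_metric R _ (borel (C01 R X)) X (fun g t => ext (g : C01 R X) t)).
  exact: measurable_ext_eval.
by move=> g; exact: ext_continuous.
Qed.

Lemma measurable_diff_quot_joint (h : R) : measurable_fun setT
  (fun z : borel (C01 R X) * measurableTypeR R => diff_quot (z.1 : C01 R X) z.2 h).
Proof.
apply: (@caratheodory_real R _ (borel (C01 R X)) (fun g t => diff_quot (g : C01 R X) t h)).
  by move=> t; apply: measurable_funM => //; exact: measurable_mdist_eval.
by move=> g; exact: continuous_diff_quot.
Qed.

End evaluation.

(** * Transfer of representatives through a change of time *)

Section transfer.
Context {R : realType}.
Local Notation mu := (@lebesgue_measure R).

(** The integral condition says that [phi] carries the measure of density [w] to one that charges no
    null set. As [w] is positive almost everywhere on (0,1), preimages of null sets under [phi] are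
    null there. *)
Lemma ae01_comp (phi w : R -> R) (Q : R -> Prop) :
  continuous phi -> (forall t, 0 < t < 1 -> 0 < phi t < 1) ->
  measurable_fun (I01 R) w -> (forall t, 0 <= w t) -> ae01 (fun t => 0 < w t) ->
  (forall N, measurable (N : set (measurableTypeR R)) -> mu N = 0%E ->
    (\int[mu]_(t in I01 R) ((\1_N (phi t))%:E * (w t)%:E) = 0)%E) ->
  ae01 Q -> ae01 (fun t => Q (phi t)).
Proof.
move=> cphi phi01 mw w0 w_gt0 phiE [N [mN N0 NP]].
have mI : measurable (I01 R : set (measurableTypeR R)) := @measurable_I01 R.
have E := phiE N mN N0.
have {}E : (\int[mu]_(t in I01 R) `|(\1_N (phi t))%:E * (w t)%:E| = 0)%E.
  by rewrite -[RHS]E; apply: eq_integral => t _; rewrite gee0_abs// mule_ge0// lee_fin.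
have mNphi : measurable_fun (I01 R) (fun t => (\1_N (phi t))%:E * (w t)%:E)%E.
  apply: emeasurable_funM; last exact/measurable_EFinP.
  apply/measurable_EFinP; apply: measurable_funTS.
  by apply: (measurableT_comp (measurable_indic mN)); exact: continuous_measurable_fun.
have /ae_eq_integral_abs H := E; have {}H := H mI mNphi.
apply: negligibleS (negligibleU H w_gt0) => t /= nQ.
apply: contrapT => /not_orP[/contrapT H1 /contrapT H2]; apply: nQ => t01.
have tI : I01 R t by rewrite /I01/= in_itv/=; have /andP[/ltW -> /ltW ->] := t01.
apply: contrapT => nQ.
have Nt : N (phi t) by apply: NP => /= /(_ (phi01 _ t01)).
have := H1 tI; rewrite indicE mem_set// mul1e => -[wt].
by have := H2 t01; rewrite wt ltxx.
Qed.

End transfer.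

Section reparametrized_rep.
Context {R : realType} {X : completeMetricType R}.
Local Notation mu := (@lebesgue_measure R).

(** The primitive [P] of [w] is taken as the new time. In that time the bound on distances becomes a
    Lipschitz bound, and the integral of [h] along the new curve is the integral weighted by [w].
    The representative found there, composed with [P], is one along [g], since [P] pulls null sets
    back to null sets. *)
Lemma equals_rep_reparam (f ft : X -> R) (h : borel X -> \bar R) (g : C01 R X)
    (w : R -> R) (L : R) :
  measurable_fun setT h -> (forall x, 0 <= h x)%E ->
  (forall g, lipschitz_curve g -> (\int[M g]_x h x < +oo)%E -> equals_rep f ft g) ->
  mu.-integrable (I01 R) (EFin \o w) -> (forall t, 0 <= w t) ->
  ae01 (fun t => 0 < w t) -> (\int[mu]_(t in I01 R) (w t)%:E = 1)%E ->
  (forall a b, 0 <= a -> a <= b -> b <= 1 ->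
    ((mdist (ext g a : X) (ext g b))%:E <= L%:E * \int[mu]_(t in `[a, b]) (w t)%:E)%E) ->
  (\int[mu]_(t in I01 R) (h (ext g t) * (w t)%:E) < +oo)%E ->
  equals_rep f ft g.
Proof.
move=> mh h0 Hft iw w0 w_gt0 w1 gL hfin.
have [P [psi [[Pp pP cP cpsi] [P0 P1 P_lt psi_lt] PE subst _]]] :=
  reparametrization iw w0 w_gt0 w1.
have psi0 : psi 0 = 0 by rewrite -{1}P0 Pp.
have psi1 : psi 1 = 1 by rewrite -{1}P1 Pp.
have psi_le a b : (psi a <= psi b) = (a <= b) by rewrite !leNgt psi_lt.
have cs : continuous (fun y => ext g (psi y) : X).
  by move=> y; apply: continuous_comp; [exact: cpsi|exact: ext_continuous].
have [sg sgE] : exists sg : C01 R X, forall t, sg t = ext g (psi (val t)).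
  by exists (curve_of cs).
have sgL : lipschitz_curve sg.
  exists L => s t; rewrite !sgE; wlog : s t / val s <= val t.
    move=> H; have [st|/ltW ts] := leP (val s) (val t); first exact: H.
    by rewrite metric_sym distrC H.
  move=> st; have /andP[s0 _] := I01_itv s; have /andP[_ t1] := I01_itv t.
  have a0 : 0 <= psi (val s) by rewrite -psi0 psi_le.
  have b1 : psi (val t) <= 1 by rewrite -psi1 psi_le.
  have ab : psi (val s) <= psi (val t) by rewrite psi_le.
  have := gL _ _ a0 ab b1; rewrite -PE// !pP -EFinM lee_fin.
  by rewrite distrC ger0_norm ?subr_ge0.
have mhg : measurable_fun setT (fun t => h (ext g t)).
  exact: (measurableT_comp mh (measurable_ext g)).
have sgh : (\int[M sg]_x h x < +oo)%E.
  rewrite ge0_integral_M//.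
  rewrite (_ : (\int[mu]_(t in _) _)%E = \int[mu]_(y in I01 R) h (ext g (psi y)))%E.
    by rewrite (subst (fun t => h (ext g t))).
  apply: eq_integral => y; rewrite inE /I01/= in_itv/= => y01.
  by rewrite /ext/= sgE val_clip.
have [fs rs ftE] := Hft sg sgL sgh.
have cf : continuous (fun t => fs (clip (P t)) : R).
  move=> t; apply: (@continuous_comp _ _ _ P (fun y => fs (clip y))); first exact: cP.
  by apply: (@continuous_comp _ _ _ (@clip R) fs); [exact: clip_continuous|exact: cts_fun].
have [fg fgE] : exists fg : C01 R R, forall t, fg t = fs (clip (P (val t))).
  by exists (curve_of cf).
have P_le a b : (P a <= P b) = (a <= b) by rewrite !leNgt P_lt.
have P01 t : 0 <= t <= 1 -> 0 <= P t <= 1.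
  by move=> /andP[t0 t1]; rewrite -P0 P_le t0 -P1 P_le t1.
have sgP t : 0 <= t <= 1 -> sg (clip (P t)) = ext g t.
  by move=> t01; rewrite sgE val_clip ?P01// Pp.
exists fg.
  have : ae01 (fun t => fs (clip (P t)) = f (sg (clip (P t)))).
    apply: (@ae01_comp _ P w (fun t => fs (clip t) = f (sg (clip t)))) => //.
    - move=> t /andP[t0 t1]; have := P_lt t 1; have := P_lt 0 t.
      by rewrite P0 P1 t0 t1 => -> ->.
    - by apply/measurable_EFinP; exact: (measurable_int mu).
    - move=> N mN N0; rewrite -(subst (fun t => (\1_N (P t))%:E)).
      + under eq_integral do rewrite pP.
        rewrite integral_indic//; last exact: measurable_I01.
        by apply: subset_measure0 N0 => //; apply: measurableI => //; exact: measurable_I01.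
      + apply/measurable_EFinP; apply: (measurableT_comp (measurable_indic mN)).
        exact: continuous_measurable_fun.
      + by move=> x; rewrite lee_fin.
  apply: ae01_imp => t /andP[/ltW t0 /ltW t1] H.
  by rewrite fgE val_clip ?t0// H sgP ?t0.
move=> t; rewrite fgE -ftE sgP ?ext_val//; exact: I01_itv.
Qed.

End reparametrized_rep.

Lemma young_poweR {R : realType} (p q : R) (x : \bar R) (y : R) :
  1 < p -> q = p / (p - 1) -> (0 <= x)%E -> 0 <= y ->
  (x * y%:E <= x `^ p + (y `^ q)%:E)%E.
Proof.
move=> p1 qE x0 y0.
have p0 : 0 < p by lra.
have p10 : 0 < p - 1 by lra.
have q0 : 0 < q by rewrite qE divr_gt0.
have qV : q^-1 = 1 - p^-1 by rewrite qE invf_div mulrBl divff ?mul1r// gt_eqF.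
case: x x0 => [x|_|//]; last by rewrite poweRyr ?gt_eqF// addye ?leey.
rewrite lee_fin => x0; rewrite poweR_EFin -EFinM -EFinD lee_fin.
apply: le_trans (conjugate_powR x0 y0 p0 q0 _) _; first by rewrite qV addrC subrK.
have p'0 : 0 < p^-1 by rewrite invr_gt0.
have p'1 : p^-1 < 1 by rewrite invf_lt1.
by apply: lerD; rewrite ler_piMr ?powR_ge0// ?qV; lra.
Qed.

(** A violated inequality would persist under small moves of an end point. The right end point is
    freed while the left one is rational, after that the left one. *)
Lemma le_rational_dense {R : realType} (d : R -> R -> R) (F : R -> R) :
  (forall a, d a a = 0) -> (forall a, continuous (d a)) ->
  (forall b, continuous (d ^~ b)) -> continuous F ->
  (forall a b : rat, 0 <= ratr a :> R -> ratr a <= ratr b :> R -> ratr b <= 1 :> R ->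
    d (ratr a) (ratr b) <= F (ratr b) - F (ratr a)) ->
  forall a b, 0 <= a -> a <= b -> b <= 1 -> d a b <= F b - F a.
Proof.
move=> dxx dc dc' cF dQ a b a0.
rewrite le_eqVlt => /predU1P[->|ab] b1; first by rewrite dxx subrr.
have dQr (r : rat) (x : R) : 0 <= ratr r :> R -> ratr r < x -> x <= 1 ->
    d (ratr r) x <= F x - F (ratr r).
  move=> r0 rx x1; rewrite leNgt; apply/negP => lt.
  have : \forall y \near x, 0 < d (ratr r) y - F y + F (ratr r).
    have : d (ratr r) y - F y + F (ratr r) @[y --> x] --> d (ratr r) x - F x + F (ratr r).
      by apply: cvgD; [apply: cvgB; [exact: dc|exact: cF]|exact: cvg_cst].
    move=> /cvgr_gt; apply; lra.
  move=> /nbhs_ballP[e /= e0 He].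
  have : Num.max (ratr r) (x - e) < x by rewrite gt_max rx/= gtrBl.
  move=> /rat_in_itvoo[k]; rewrite in_itv/= gt_max => /andP[/andP[rk xk] kx].
  have := He (ratr k); rewrite /ball/= gtr0_norm ?subr_gt0// => /(_ _).
  have -> : x - ratr k < e by lra.
  move=> /(_ isT); have := dQ r k r0 (ltW rk) (le_trans (ltW kx) x1); lra.
rewrite leNgt; apply/negP => lt.
have : \forall y \near a, 0 < d y b - F b + F y.
  have : d y b - F b + F y @[y --> a] --> d a b - F b + F a.
    by apply: cvgD; [apply: cvgB; [exact: dc'|exact: cvg_cst]|exact: cF].
  move=> /cvgr_gt; apply; lra.
move=> /nbhs_ballP[e /= e0 He].
have : a < Num.min b (a + e) by rewrite lt_min ab/= ltrDl.
move=> /rat_in_itvoo[k]; rewrite in_itv/= lt_min => /andP[ak /andP[kb ke]].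
have := He (ratr k); rewrite /ball/= ltr0_norm ?subr_lt0// => /(_ _).
have -> : - (a - ratr k) < e by lra.
by move=> /(_ isT); have := dQr k b (le_trans a0 (ltW ak)) kb b1; lra.
Qed.

Section speed.
Context {R : realType} {X : completeMetricType R}.
Local Notation mu := (@lebesgue_measure R).
Implicit Types g : C01 R X.

(* Agrees almost everywhere with [mderiv g] when [g] is absolutely continuous,
   but its joint measurability in [g] and [t] is immediate. *)
Definition speed g (t : R) : R :=
  fine (limn_esup (fun n => (diff_quot g t n.+1%:R^-1)%:E)).

Lemma speed_ge0 g t : 0 <= speed g t.
Proof.
apply: fine_ge0; apply: limf_esup_ge0 => [|n].
  by move=> [n _ Hn]; exact: (Hn n (leqnn n)).
by rewrite lee_fin divr_ge0// mdist_ge0.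
Qed.

Lemma measurable_speed_joint : measurable_fun setT
  (fun z : borel (C01 R X) * measurableTypeR R => speed (z.1 : C01 R X) z.2).
Proof.
apply: (measurableT_comp (fine_measurable measurableT)).
apply: (@measurable_fun_limn_esup _ _ _ _ (fun n (z : borel (C01 R X) * measurableTypeR R) =>
   (diff_quot (z.1 : C01 R X) z.2 n.+1%:R^-1)%:E)) => n.
apply/measurable_EFinP; exact: measurable_diff_quot_joint.
Qed.

Lemma measurable_speed g : measurable_fun setT (speed g).
Proof.
exact: (measurable_fun_pair2 (g : borel (C01 R X)) measurable_speed_joint).
Qed.

Lemma speed_mderiv g : abs_cont g -> \forall t \ae mu, speed g t = mderiv g t.
Proof.
move=> /abs_cont_mderiv[_ _ cvg].
apply: negligibleS cvg => t /=; apply: contra_not => ct.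
rewrite /speed; suff /cvg_limn_einf_sup[_ ->] :
  (diff_quot g t n.+1%:R^-1)%:E @[n --> \oo] --> (mderiv g t)%:E by [].
apply: cvg_EFin; first exact: nearW.
apply: (@cvg_comp _ _ _ (fun n : nat => n.+1%:R^-1 : R) (diff_quot g t) _ (0^')); last exact: ct.
move=> A /nbhs_ballP[e /= e0 eA]; have := near_infty_natSinv_lt (PosNum e0).
apply: filterS => n ne; apply: eA; last by rewrite /= invr_eq0 pnatr_eq0.
by rewrite /ball/= sub0r normrN gtr0_norm.
Qed.

Lemma continuous_mdist_ext g (s : R) : continuous (fun t => mdist (ext g s : X) (ext g t)).
Proof.
move=> t; apply/cvgrPdist_lt => e e0.
have := @ext_continuous R X g t; move=> /metricType_numDomainType.cvgrPdist_lt/(_ _ e0).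
apply: filterS => r tr; apply: le_lt_trans tr.
have := metric_triangle (ext g s : X) (ext g t) (ext g r).
have := metric_triangle (ext g s : X) (ext g r) (ext g t).
rewrite (metric_sym (ext g r) (ext g t)) ler_norml => *; apply/andP; split; lra.
Qed.

(** The deterministic half of the statement on test plans. Its three conditions on [g] are phrased
    with [speed] and rational times because they will have to define a Borel set of curves. *)
Lemma equals_rep_speed (f ft : X -> R) (h : borel X -> \bar R) (p q : R) g :
  1 < p -> q = p / (p - 1) -> measurable_fun setT h -> (forall x, 0 <= h x)%E ->
  (forall g, lipschitz_curve g -> (\int[M g]_x h x < +oo)%E -> equals_rep f ft g) ->
  (forall a b : rat, 0 <= ratr a :> R -> ratr a <= ratr b :> R -> ratr b <= 1 :> R ->
    ((mdist (ext g (ratr a) : X) (ext g (ratr b)))%:E <=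
      \int[mu]_(t in `[ratr a, ratr b]) (speed g t)%:E)%E) ->
  (\int[mu]_(t in I01 R) (speed g t `^ q)%:E < +oo)%E ->
  (\int[mu]_(t in I01 R) (h (ext g t) `^ p) < +oo)%E ->
  equals_rep f ft g.
Proof.
move=> p1 qE mh h0 Hft gQ Dq hp.
have mI : measurable (I01 R : set (measurableTypeR R)) := @measurable_I01 R.
have mD := measurable_speed g; have D0 := speed_ge0 g.
have mhg : measurable_fun setT (fun t => h (ext g t)).
  exact: (measurableT_comp mh (measurable_ext g)).
have muI : mu (I01 R) = 1%E.
  by rewrite /I01 lebesgue_measure_itv/= lte_fin ltr01 oppr0 adde0.
have int1 : (\int[mu]_(t in I01 R) 1 = 1)%E.
  by rewrite integral_cst// mul1e; exact: muI.
have mDq : measurable_fun setT (fun t => (speed g t `^ q)%:E).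
  by apply/measurable_EFinP; exact: (measurableT_comp (measurable_powR q)).
have mhp : measurable_fun setT (fun t => (h (ext g t) `^ p)%E).
  exact: (measurableT_comp (measurable_poweR p) mhg).
have hp0 t : (0 <= h (ext g t) `^ p)%E by exact: poweR_ge0.
have Dq0 t : (0 <= (speed g t `^ q)%:E)%E by rewrite lee_fin powR_ge0.
(* Young's inequality with the other factor equal to 1 bounds the speed by 1 plus its q-th power. *)
have iD : mu.-integrable (I01 R) (EFin \o speed g).
  apply/integrableP; split; first by apply/measurable_EFinP; exact: measurable_funTS.
  apply: (@le_lt_trans _ _ (\int[mu]_(t in I01 R) (1 + (speed g t `^ q)%:E))%E).
    apply: ge0_le_integral => //.
    - by apply: measurable_funTS; apply: measurableT_comp => //; exact/measurable_EFinP.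
    - by apply: measurable_funTS; exact: emeasurable_funD.
    - move=> t _ /=; rewrite ger0_norm//.
      have := @young_poweR R p q 1%E (speed g t) p1 qE lee01 (D0 t).
      by rewrite mul1e poweR1r.
  rewrite ge0_integralD//; last exact: measurable_funTS.
  by rewrite int1 lte_add_pinfty// ltry.
pose l := \int[mu]_(t in I01 R) speed g t.
have l0 : 0 <= l by exact: Rintegral_ge0.
have l1 : 0 < 1 + l by rewrite ltr_pwDl.
have lE : (l%:E = \int[mu]_(t in I01 R) (speed g t)%:E)%E.
  by rewrite /l /Rintegral fineK//; exact: integrable_fin_num.
(* The summand 1 keeps the weight positive where the curve is at rest, and 1 + l normalizes its
   integral to 1; the Lipschitz constant of the new curve is then 1 + l. *)
pose w t := (1 + speed g t) / (1 + l).
have w0 t : 0 <= w t by rewrite divr_ge0 ?addr_ge0// ltW.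
have i1D : mu.-integrable (I01 R) (EFin \o (fun t => 1 + speed g t)).
  have i1 : mu.-integrable (I01 R) (EFin \o cst 1).
    apply: continuous_compact_integrable; first exact: segment_compact.
    by apply: continuous_subspaceT => x; exact: cst_continuous.
  by apply: eq_integrable (integrableD mI i1 iD).
have iw : mu.-integrable (I01 R) (EFin \o w).
  by apply: eq_integrable (integrableZr mI (1 + l)^-1 i1D).
have m1D : measurable_fun setT (fun t => (1 + speed g t)%:E).
  by apply/measurable_EFinP; exact: measurable_funD.
have mw : measurable_fun setT (fun t => (w t)%:E).
  by apply/measurable_EFinP; apply: measurable_funM => //; exact: measurable_funD.
have wE (A : set R) : measurable (A : set (measurableTypeR R)) ->
   ((1 + l)%:E * \int[mu]_(t in A) (w t)%:E = \int[mu]_(t in A) (1 + speed g t)%:E)%E.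
  move=> mA; rewrite -ge0_integralZl//=.
  - apply: eq_integral => t _; rewrite -EFinM /w mulrC divfK//; exact: lt0r_neq0.
  - exact: measurable_funTS.
  - by move=> t _; rewrite lee_fin.
  - by rewrite lee_fin ltW.
have gR a b : 0 <= a -> a <= b -> b <= 1 ->
    ((mdist (ext g a : X) (ext g b))%:E <= \int[mu]_(t in `[a, b]) (speed g t)%:E)%E.
  pose U := speed g \_ (I01 R).
  have iU : mu.-integrable setT (EFin \o U).
    by rewrite /U -restrict_EFin; exact: (proj1 (integrable_mkcond _ _)).
  have UE x y : 0 <= x -> x <= y -> y <= 1 ->
      (\int[mu]_(t in `[x, y]) (speed g t)%:E = (prim U y - prim U x)%:E)%E.
    move=> x0 xy y1; rewrite EFin_primB//; apply: eq_integral => t.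
    rewrite inE/= in_itv/= => /andP[xt ty]; rewrite /U patchE mem_set//.
    by rewrite /I01/= in_itv/= (le_trans x0 xt) (le_trans ty y1).
  move=> a0 ab b1; rewrite UE// lee_fin.
  apply: (@le_rational_dense _ (fun a b => mdist (ext g a : X) (ext g b))) => //.
  - by move=> x; exact: mdistxx.
  - exact: continuous_mdist_ext.
  - move=> y; rewrite (_ : (fun x => _) = fun x => mdist (ext g y : X) (ext g x)).
      exact: continuous_mdist_ext.
    by apply/funext => x; rewrite metric_sym.
  - exact: prim_continuous.
  - by move=> x y x0 xy y1; rewrite -lee_fin -UE//; exact: gQ.
apply: (@equals_rep_reparam R X f ft h g w (1 + l)) => //.
- apply: (@ae01P R) => //; exists set0; split=> // t /=; apply: contra_notP => _.
  by rewrite divr_gt0// ltr_pwDl.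
- have wf : (\int[mu]_(t in I01 R) (w t)%:E)%E \is a fin_num by exact: integrable_fin_num.
  have := wE _ mI; under [RHS]eq_integral do rewrite EFinD.
  rewrite ge0_integralD//; last 2 first.
  - by move=> t _; rewrite lee_fin.
  - by apply: measurable_funTS; exact/measurable_EFinP.
  rewrite int1 -lE -(fineK wf) -EFinM -EFinD => -[E]; congr EFin.
  by apply: (mulfI (lt0r_neq0 l1)); rewrite E mulr1.
- move=> a b a0 ab b1; rewrite wE//; apply: le_trans (gR _ _ a0 ab b1) _.
  apply: ge0_le_integral => //.
  - by move=> t _; rewrite lee_fin.
  - by apply: measurable_funTS; exact/measurable_EFinP.
  - exact: measurable_funTS.
  - by move=> t _; rewrite lee_fin lerDr.
(* The factor 1 / (1 + l) <= 1 is dropped, and Young's inequality is used twice: for [h] times 1 and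
   for [h] times the speed. *)
apply: (@le_lt_trans _ _ (\int[mu]_(t in I01 R) ((1 + h (ext g t) `^ p) + (h (ext g t) `^ p + (speed g t `^ q)%:E)))%E).
  apply: ge0_le_integral => //.
  - by move=> t _; rewrite mule_ge0// lee_fin.
  - by apply: measurable_funTS; exact: emeasurable_funM.
  - apply: measurable_funTS; apply: emeasurable_funD; exact: emeasurable_funD.
  - move=> t _; apply: (@le_trans _ _ (h (ext g t) * (1 + speed g t)%:E)%E).
      apply: lee_wpmul2l => //; rewrite lee_fin /w ler_pdivrMr// ler_peMr ?lerDl//.
      exact: addr_ge0.
    rewrite EFinD ge0_muleDr ?lee_fin//; apply: leeD; last exact: young_poweR.
    have := @young_poweR R p q (h (ext g t)) 1 p1 qE (h0 _) ler01.
    by rewrite powR1 addeC.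
rewrite !ge0_integralD//.
- rewrite int1; apply: lte_add_pinfty; last exact: lte_add_pinfty.
  by apply: lte_add_pinfty => //; exact: ltry.
- exact: measurable_funTS.
- exact: measurable_funTS.
- exact: measurable_funTS.
- by move=> t _; rewrite adde_ge0.
- apply: measurable_funTS; exact: emeasurable_funD.
- by move=> t _; rewrite adde_ge0.
- apply: measurable_funTS; exact: emeasurable_funD.
Qed.

End speed.

Section test_plans.
Context {R : realType} {X : completeMetricType R}.
Local Notation mu := (@lebesgue_measure R).
Variables (m : {finite_measure set (borel X) -> \bar R}) (p q : R).
Hypotheses (p1 : 1 < p) (qE : q = p / (p - 1)).

Let measurable_param (F : borel (C01 R X) * measurableTypeR R -> \bar R) :
  measurable_fun setT F -> (forall z, 0 <= F z)%E ->
  measurable_fun setT (fun g : borel (C01 R X) => \int[leb01 R]_t F (g, t))%E.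
Proof.
move=> mF F0; exact: (@measurable_fun_fubini_tonelli_F _ _ _ _ R (leb01 R) F).
Qed.

Let integral_leb01_itv (F : R -> R) (a b : R) : measurable_fun setT F ->
  (forall t, 0 <= F t) -> 0 <= a -> b <= 1 ->
  (\int[leb01 R]_t (F t * \1_(`[a, b]) t)%:E = \int[mu]_(t in `[a, b]) (F t)%:E)%E.
Proof.
move=> mF F0 a0 b1; rewrite ge0_integral_leb01; last 2 first.
- by apply/measurable_EFinP; apply: measurable_funM.
- by move=> t; rewrite lee_fin mulr_ge0.
rewrite [LHS]integral_mkcond [RHS]integral_mkcond; apply: eq_integral => t _.
rewrite !patchE indicE; have [tab|tab] := boolP (t \in `[a, b]%classic).
  rewrite mulr1 mem_set//; move: tab; rewrite inE /I01/= !in_itv/= => /andP[at_ tb].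
  by rewrite (le_trans a0 at_) (le_trans tb b1).
by rewrite mulr0; case: ifP.
Qed.

(** A countable substitute for absolute continuity: with rational end points the set of such curves
    is Borel, and continuity recovers the real ones. *)
Let steady (g : C01 R X) := forall a b : rat,
  0 <= ratr a :> R -> ratr a <= ratr b :> R -> ratr b <= 1 :> R ->
  ((mdist (ext g (ratr a) : X) (ext g (ratr b)))%:E <=
    \int[mu]_(t in `[ratr a, ratr b]) (speed g t)%:E)%E.

Let measurable_steady : measurable ([set g | steady g] : set (borel (C01 R X))).
Proof.
rewrite -[X in measurable X]setCK; apply: measurableC.
rewrite (_ : ~` _ = \bigcup_(ab : rat * rat) [set g : C01 R X |
    [/\ 0 <= ratr ab.1 :> R, ratr ab.1 <= ratr ab.2 :> R, ratr ab.2 <= 1 :> R &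
    ~ ((mdist (ext g (ratr ab.1) : X) (ext g (ratr ab.2)))%:E <=
    \int[mu]_(t in `[ratr ab.1, ratr ab.2]) (speed g t)%:E)%E]]); last first.
  apply/seteqP; split=> [g|g [[a b] _ /= [a0 ab b1 H] K]].
    move=> /existsNP[a /existsNP[b /not_implyP[a0 /not_implyP[ab /not_implyP[b1 H]]]]].
    by exists (a, b).
  by apply: H; exact: K.
apply: countable_bigcupT_measurable => [|[a b]]; first exact: countableP.
rewrite /=; have [[a0 ab b1]|nc] := pselect [/\ 0 <= ratr a :> R, ratr a <= ratr b :> R & ratr b <= 1 :> R]; last first.
  rewrite (_ : [set _ | _] = set0); first exact: measurable0.
  by apply/seteqP; split=> // g [a0 ab b1 _]; apply: nc.
pose F (z : borel (C01 R X) * measurableTypeR R) : \bar R :=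
  (speed (z.1 : C01 R X) z.2 * \1_(`[ratr a, ratr b]) z.2)%:E.
have mF : measurable_fun setT F.
  apply/measurable_EFinP; apply: measurable_funM; first exact: measurable_speed_joint.
  apply: (measurableT_comp _ measurable_snd).
  by apply: measurable_indic; exact: measurable_itv.
have F0 z : (0 <= F z)%E by rewrite lee_fin mulr_ge0// speed_ge0.
rewrite (_ : [set _ | _] = ~` [set g : borel (C01 R X) |
    ((mdist (ext g (ratr a) : X) (ext g (ratr b)))%:E <= \int[leb01 R]_t F (g, t))%E]).
  apply: measurableC; rewrite -[X in measurable X]setTI.
  apply: measurable_lee => //; last exact: measurable_param.
  by apply/measurable_EFinP; exact: measurable_mdist_eval.
apply/seteqP; split=> g /=.
  move=> [_ _ _ H]; rewrite /F/= integral_leb01_itv//; first exact: measurable_speed.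
  exact: speed_ge0.
by rewrite /F/= integral_leb01_itv//; [exact: measurable_speed|exact: speed_ge0].
Qed.

Let ACq_steady (g : C01 R X) : ACq q g ->
  steady g /\ (\int[leb01 R]_t (speed g t `^ q)%:E < +oo)%E.
Proof.
move=> [ag gq]; have [im dm _] := abs_cont_mderiv ag.
have sm := speed_mderiv ag.
have mI : measurable (I01 R : set (measurableTypeR R)) := @measurable_I01 R.
have msp : measurable_fun setT (fun t => (speed g t)%:E).
  by apply/measurable_EFinP; exact: measurable_speed.
have msq : measurable_fun setT (fun t => (speed g t `^ q)%:E).
  apply/measurable_EFinP; apply: (measurableT_comp (measurable_powR q)).
  exact: measurable_speed.
have mmd : measurable_fun setT (fun t => (mderiv g t)%:E).
  by apply/measurable_EFinP; exact: measurable_mderiv.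
split.
  move=> a b a0 ab b1.
  rewrite (@ae_eq_integral _ _ R mu _ (fun t => (mderiv g t)%:E))//.
  - by rewrite -EFin_primB// lee_fin; exact: dm.
  - exact: measurable_funTS.
  - exact: measurable_funTS.
  - by apply: negligibleS sm => t /=; apply: contra_not => -> _.
rewrite ge0_integral_leb01; [|exact: msq|by move=> t; rewrite lee_fin powR_ge0].
rewrite (@ae_eq_integral _ _ R mu _ (fun t => (mderiv g t `^ q)%:E))//.
- exact: measurable_funTS.
- apply: measurable_funTS; apply/measurable_EFinP.
  by apply: (measurableT_comp (measurable_powR q)); exact: measurable_mderiv.
- by apply: negligibleS sm => t /=; apply: contra_not => -> _.
Qed.

Let measurable_h_joint (h : borel X -> \bar R) : measurable_fun setT h ->
  measurable_fun setT (fun z : borel (C01 R X) * measurableTypeR R =>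
    h (ext (z.1 : C01 R X) z.2) `^ p)%E.
Proof.
move=> mh; apply: (measurableT_comp (measurable_poweR p)).
exact: (measurableT_comp mh measurable_ext_joint).
Qed.

(** The bound on the marginals makes the expectation of h^p at each time at most [C] times the
    energy of [h]. By Tonelli the expectation of its time integral is finite, hence so is the time
    integral for almost every curve. *)
Let test_plan_finite (h : borel X -> \bar R) (rho : probability (borel (C01 R X)) R) :
  Lplus p m h -> test_plan m q rho ->
  rho.-negligible [set g | ~ (\int[leb01 R]_t (h (ext g t) `^ p) < +oo)%E].
Proof.
move=> [mh h0 hp] [_ [C C0 rhoC]].
pose F (z : borel (C01 R X) * measurableTypeR R) := (h (ext (z.1 : C01 R X) z.2) `^ p)%E.
have mF : measurable_fun setT F by exact: measurable_h_joint.
have F0 z : (0 <= F z)%E by exact: poweR_ge0.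
have mhp : measurable_fun setT (fun x => h x `^ p)%E.
  exact: (measurableT_comp (measurable_poweR p)).
have hp0 x : (0 <= h x `^ p)%E by exact: poweR_ge0.
pose CC : {nonneg R} := NngNum (ltW C0).
have slice t : (\int[rho]_g F (g, t) <= C%:E * \int[m]_x (h x `^ p))%E.
  rewrite -(@ge0_integral_mscale _ _ R m setT measurableT CC)//.
  have := ge0_integral_pushforward (measurable_ext_eval (X := X) t) rho measurableT mhp
    (fun y _ => hp0 y).
  rewrite /= => <-.
  pose nu : {measure set (borel X) -> \bar R} :=
    @measure_function_pushforward__canonical__measure_function_Measure
      _ _ _ _ _ rho _ (measurable_ext_eval (X := X) t).
  apply: (@ge0_le_measure_integral _ _ R nu (mscale CC m)) => //.
  by move=> S mS; exact: (rhoC (clip t)).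
have Ffin : (\int[rho]_g \int[leb01 R]_t F (g, t) < +oo)%E.
  rewrite (@fubini_tonelli _ _ _ _ R rho (leb01 R) F)//.
  apply: (@le_lt_trans _ _ (\int[leb01 R]_t (C%:E * \int[m]_x (h x `^ p)))%E).
    apply: ge0_le_integral => //.
    - by move=> t _; exact: integral_ge0.
    - exact: (@measurable_fun_fubini_tonelli_G _ _ _ _ R rho F).
  rewrite integral_cst//.
  have E : leb01 R setT = 1%E.
    rewrite /leb01/= /mrestr setTI /I01.
    by have := @lebesgue_measure_itv R `[0, 1]; rewrite /= lte_fin ltr01 oppr0 adde0.
  by rewrite [X in (_ * X < _)%E]E mule1 lte_mul_pinfty// ?lee_fin ?(ltW C0).
have ci : rho.-integrable setT (fun g => \int[leb01 R]_t F (g, t))%E.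
  apply/integrableP; split; first exact: measurable_param.
  by under eq_integral do (rewrite gee0_abs; last exact: integral_ge0).
apply: negligibleS (integrable_ae measurableT ci) => g /= ng H; apply: ng.
by have := H I; rewrite ge0_fin_numE//; exact: integral_ge0.
Qed.

(** The set of curves where the property fails need not be measurable itself, so it is enclosed in
    the complement of a Borel set [G]. Each of the three conditions defining [G] holds almost surely
    under every test plan. *)
Lemma q_ae_equals_rep (f ft : X -> R) (h : borel X -> \bar R) :
  Lplus p m h ->
  (forall g, lipschitz_curve g -> (\int[M g]_x h x < +oo)%E -> equals_rep f ft g) ->
  q_ae m q (equals_rep f ft).
Proof.
move=> Lh Hft; have [mh h0 _] := Lh.
pose G2 : set (borel (C01 R X)) := [set g | \int[leb01 R]_t (speed g t `^ q)%:E < +oo]%E.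
pose G3 : set (borel (C01 R X)) := [set g | \int[leb01 R]_t (h (ext g t) `^ p) < +oo]%E.
have mhj := measurable_h_joint mh.
have mG2 : measurable G2.
  rewrite -[X in measurable X]setTI; apply: emeasurable_fun_infty_o => //.
  apply: (@measurable_param (fun z => (speed (z.1 : C01 R X) z.2 `^ q)%:E)).
    apply/measurable_EFinP; apply: (measurableT_comp (measurable_powR q)).
    exact: measurable_speed_joint.
  by move=> z; rewrite lee_fin powR_ge0.
have mG3 : measurable G3.
  rewrite -[X in measurable X]setTI; apply: emeasurable_fun_infty_o => //.
  by apply: (measurable_param mhj) => z; exact: poweR_ge0.
pose G : set (borel (C01 R X)) := [set g | steady g] `&` (G2 `&` G3).
have mG : measurable G by apply: measurableI => //; exact: measurableI.
exists (~` G).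
  split.
    move=> nu; exists (~` G); first exact: measurableC.
    by rewrite setYK; exact: negligible_set0.
  move=> rho rt; have [rA _] := rt.
  apply: negligibleS (negligibleU rA (test_plan_finite Lh rt)) => g nG.
  apply: contrapT => /not_orP[/contrapT /ACq_steady[s1 s2] /contrapT s3].
  by apply: nG; split => //; split.
move=> g ng [sg [g2 g3]]; apply: ng.
have msq : measurable_fun setT (fun t => (speed g t `^ q)%:E).
  apply/measurable_EFinP; apply: (measurableT_comp (measurable_powR q)).
  exact: measurable_speed.
apply: (equals_rep_speed p1 qE mh h0 Hft sg).
  by move: g2; rewrite /G2/= ge0_integral_leb01// => t; rewrite lee_fin powR_ge0.
move: g3; rewrite /G3/= ge0_integral_leb01//; last by move=> t; exact: poweR_ge0.
apply: (measurableT_comp (measurable_poweR p)).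
exact: (measurableT_comp mh (measurable_ext g)).
Qed.

End test_plans.

(** * Curves of constant speed *)

Section constant_speed.
Context {R : realType} {X : completeMetricType R}.
Local Notation mu := (@lebesgue_measure R).
Implicit Types g : C01 R X.

Let mI : measurable (I01 R : set (measurableTypeR R)) := @measurable_I01 R.

Lemma integral_itv_cst (a b r : R) : a <= b ->
  (\int[mu]_(t in `[a, b]) (r%:E) = (r * (b - a))%:E)%E.
Proof.
move=> ab; rewrite (integral_cst mu (measurable_itv _) r%:E).
have := @lebesgue_measure_itv R `[a, b]; rewrite /= lte_fin -EFinD => ->.
rewrite EFinM; congr (_ * _)%E.
by case: ltP => // ba; rewrite (le_anti (introT andP (conj ab ba))) subrr.
Qed.

Let length_fin g : abs_cont g ->
  curve_length g = (fine (curve_length g))%:E.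
Proof.
move=> /abs_cont_mderiv[im _ _]; rewrite fineK//.
by apply: integrable_fin_num => //; exact: integrableS im.
Qed.

Lemma constant_speed_lipschitz g : constant_speed g -> lipschitz_curve g.
Proof.
move=> [ag l0 lE]; have [im dm _] := abs_cont_mderiv ag.
exists (fine (curve_length g)) => s t; wlog : s t / val s <= val t.
  move=> H; have [st|/ltW ts] := leP (val s) (val t); first exact: H.
  by rewrite metric_sym distrC H.
move=> st; rewrite distrC ger0_norm ?subr_ge0// -!ext_val.
apply: le_trans (dm _ _ st) _; rewrite -lee_fin EFin_primB//.
rewrite -integral_itv_cst// (@ae_eq_integral _ _ R mu _ (cst (fine (curve_length g))%:E))//.
- by apply: measurable_funTS; apply/measurable_EFinP; exact: measurable_mderiv.
- apply: negligibleS (ae01_I01 lE) => r /=; apply: contra_not => H rst.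
  rewrite -length_fin//; apply: H; move: rst.
  rewrite /I01/= !in_itv/= => /andP[sr rt].
  have /andP[s0 _] := I01_itv s; have /andP[_ t1] := I01_itv t.
  by rewrite (le_trans s0 sr) (le_trans rt t1).
Qed.

Lemma integral_J_infinite g (h : borel X -> \bar R) : constant_speed g ->
  measurable_fun setT h -> (forall x, 0 <= h x)%E ->
  (\int[M g]_x h x = +oo)%E -> (\int[J g]_x h x = +oo)%E.
Proof.
move=> [ag l0 lE] mh h0 hM.
have mm := @measurable_mderiv R X g; have m0 := @mderiv_ge0 R X g.
have mhg : measurable_fun setT (h \o ext g) by exact: measurableT_comp (measurable_ext g).
have -> : (\int[J g]_x h x = \int[speed_measure g]_t h (ext g t))%E.
  by rewrite (ge0_integral_pushforward (measurable_ext g) (speed_measure g) measurableT mh (fun y _ => h0 y)).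
rewrite (@ge0_integral_density _ _ R (speed_measure g) (leb01 R) (mderiv g))//.
have mhm : measurable_fun setT (fun t => h (ext g t) * (mderiv g t)%:E)%E.
  by apply: emeasurable_funM => //; exact/measurable_EFinP.
rewrite ge0_integral_leb01; [|exact: mhm|by move=> t; rewrite mule_ge0// lee_fin].
rewrite (@ae_eq_integral _ _ R mu _ (fun t => curve_length g * h (ext g t))%E)//.
- rewrite ge0_integralZl//; last 2 first.
  + exact: measurable_funTS.
  + exact: ltW.
  by rewrite -ge0_integral_M// hM gt0_muley.
- exact: measurable_funTS.
- by apply: measurable_funTS; exact: measurable_funeM.
- apply: negligibleS (ae01_I01 lE) => t /=; apply: contra_not => H tI.
  by rewrite H// muleC.
Qed.

(** Chain rule: the difference quotient of [sg] with increment [k] is that of [g] with increment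
    [hk k], divided by the slope of [P] over it. As [psi] is continuous and injective, [hk k] tends
    to 0 without vanishing. *)
Lemma mderiv_reparam g (P psi : R -> R) (w : R) (t : R) (sg : C01 R X) :
  cancel P psi -> cancel psi P -> continuous psi -> 0 < P t < 1 ->
  (forall y, 0 <= y <= 1 -> ext sg y = ext g (psi y)) ->
  (P (t + h) - P t) / h @[h --> 0^'] --> w -> 0 < w ->
  diff_quot g t h @[h --> 0^'] --> mderiv g t ->
  mderiv sg (P t) = mderiv g t / w.
Proof.
move=> Pp pP cpsi /andP[y0 y1] sgE cw w0 cg.
have wn0 : w != 0 by rewrite gt_eqF.
have cPhi : diff_quot g t h / `|(P (t + h) - P t) / h| @[h --> 0^'] --> mderiv g t / w.
  apply: cvgM => //; rewrite -[w in X in _ --> X](gtr0_norm w0).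
  by apply: cvgV; [rewrite normr_eq0|apply: cvg_norm].
pose hk k := psi (P t + k) - t.
have chk : hk k @[k --> 0^'] --> (0 : R)^'.
  move=> A /nbhs_ballP[e /= e0 eA].
  have : psi (P t + k) @[k --> (0 : R)] --> psi (P t + 0).
    apply: (@continuous_comp _ _ _ (fun k => P t + k) psi); last exact: cpsi.
    by apply: cvgD; [exact: cvg_cst|exact: cvg_id].
  rewrite addr0 Pp => /cvgrPdist_lt/(_ _ e0) /nbhs_ballP[r /= r0 rP].
  apply/nbhs_ballP; exists r => // k kr k0; apply: eA.
    by rewrite /ball/= sub0r normrN /hk distrC; exact: rP.
  rewrite /hk subr_eq0; apply: contra k0 => /eqP tE.
  by have := pP (P t + k); rewrite tE => /eqP; rewrite -subr_eq0 opprD addrA subrr sub0r oppr_eq0.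
rewrite /mderiv; apply/cvg_lim => //.
have := cvg_comp _ _ chk cPhi; apply: cvg_trans; apply: near_eq_cvg; near=> k.
have k0 : k != 0 by near: k; exact: nbhs_dnbhs_neq.
have hk0 : hk k != 0.
  rewrite /hk subr_eq0; apply: contra k0 => /eqP tE.
  by have := pP (P t + k); rewrite tE => /eqP; rewrite -subr_eq0 opprD addrA subrr sub0r oppr_eq0.
(* Keeps P t + k inside [0,1], where [sg] is given by [psi]. *)
have kr : `|k| < Num.min (P t) (1 - P t).
  by near: k; apply: dnbhs0_lt; rewrite lt_min y0 subr_gt0.
have [k1 k2] : `|k| < P t /\ `|k| < 1 - P t by move: kr; rewrite lt_min => /andP.
have thk : t + hk k = psi (P t + k) by rewrite /hk addrC subrK.
have kE : P t + k - P t = k by rewrite addrAC subrr add0r.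
rewrite /= /diff_quot thk pP kE.
rewrite (sgE (P t)) ?(ltW y0) ?(ltW y1)// Pp sgE; last first.
  by move: k1 k2; rewrite !ltr_norml => /andP[? ?] /andP[? ?]; apply/andP; split; lra.
rewrite normrM normfV invfM invrK -mulrA; congr (_ * _).
by rewrite mulrCA mulVf ?mulr1// normr_eq0.
Unshelve. all: by end_near. Qed.

End constant_speed.

Section constant_speed_representative.
Context {R : realType} {X : completeMetricType R}.
Local Notation mu := (@lebesgue_measure R).
Implicit Types g : C01 R X.

Let mI : measurable (I01 R : set (measurableTypeR R)) := @measurable_I01 R.

(** The new time is arc length divided by the total length. Besides the constant speed, [reparam]
    demands that both changes of time be absolutely continuous: [w] is the density of [P], and 1 / w
    (psi y) that of [psi]. *)
Lemma constant_speed_reparam g : regular_curve g -> exists sg,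
  [/\ regular_curve sg, reparam sg g & constant_speed sg].
Proof.
move=> [ag g0]; have [im dm cvm] := abs_cont_mderiv ag.
have mm := @measurable_mderiv R X g; have m0 := @mderiv_ge0 R X g.
have imI : mu.-integrable (I01 R) (EFin \o mderiv g) by exact: integrableS im.
have muI : mu (I01 R) = 1%E.
  by rewrite /I01 lebesgue_measure_itv/= lte_fin ltr01 oppr0 adde0.
pose l := \int[mu]_(t in I01 R) mderiv g t.
have lE : (l%:E = \int[mu]_(t in I01 R) (mderiv g t)%:E)%E.
  by rewrite /l /Rintegral fineK//; exact: integrable_fin_num.
have l0 : 0 < l.
  rewrite lt_neqAle Rintegral_ge0// andbT; apply/eqP => lz.
  have E : (\int[mu]_(t in I01 R) `|(mderiv g t)%:E| = 0)%E.
    transitivity (l%:E); last by rewrite -lz.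
    by rewrite lE; apply: eq_integral => t _; rewrite gee0_abs ?lee_fin.
  have mmI : measurable_fun (I01 R) (fun t => (mderiv g t)%:E).
    by apply: measurable_funTS; exact/measurable_EFinP.
  have /ae_eq_integral_abs H := E; have {}H := H mI mmI.
  have [N [mN N0 NP]] := negligibleU H (ae01_I01 g0).
  have : (mu (I01 R) <= mu N)%E.
    apply: le_measure; rewrite ?inE// => t tI; apply: NP; apply: contrapT.
    move=> /not_orP[/contrapT /(_ tI) [+] /contrapT /(_ tI)].
    by move=> -> ; rewrite ltxx.
  by rewrite muI [leRHS]N0 lee_fin ler10.
pose w t := mderiv g t / l.
have w0 t : 0 <= w t by rewrite divr_ge0// ltW.
have iw : mu.-integrable (I01 R) (EFin \o w).
  by apply: eq_integrable (integrableZr mI l^-1 imI).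
have w_gt0 : ae01 (fun t => 0 < w t).
  by apply: ae01_imp g0 => t _ t0; rewrite divr_gt0.
have wE (A : set R) : measurable (A : set (measurableTypeR R)) ->
   (l%:E * \int[mu]_(t in A) (w t)%:E = \int[mu]_(t in A) (mderiv g t)%:E)%E.
  move=> mA; rewrite -ge0_integralZl//=.
  - apply: eq_integral => t _; rewrite -EFinM /w mulrC divfK//; exact: lt0r_neq0.
  - apply: measurable_funTS; apply/measurable_EFinP; exact: measurable_funM.
  - by move=> t _; rewrite lee_fin.
  - by rewrite lee_fin ltW.
have w1 : (\int[mu]_(t in I01 R) (w t)%:E = 1)%E.
  have wf : (\int[mu]_(t in I01 R) (w t)%:E)%E \is a fin_num by exact: integrable_fin_num.
  have := wE _ mI; rewrite -lE -(fineK wf) -EFinM => -[E]; congr EFin.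
  by apply: (mulfI (lt0r_neq0 l0)); rewrite E mulr1.
have [P [psi [[Pp pP cP cpsi] [P0 P1 P_lt psi_lt] PE subst cvP]]] :=
  reparametrization iw w0 w_gt0 w1.
have psi0 : psi 0 = 0 by rewrite -{1}P0 Pp.
have psi1 : psi 1 = 1 by rewrite -{1}P1 Pp.
have psi_le a b : (psi a <= psi b) = (a <= b) by rewrite !leNgt psi_lt.
have P_le a b : (P a <= P b) = (a <= b) by rewrite !leNgt P_lt.
have psi01 t : 0 <= t <= 1 -> 0 <= psi t <= 1.
  by move=> /andP[t0 t1]; rewrite -psi0 psi_le t0 -psi1 psi_le t1.
have P01 t : 0 <= t <= 1 -> 0 <= P t <= 1.
  by move=> /andP[t0 t1]; rewrite -P0 P_le t0 -P1 P_le t1.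
have P01' t : 0 < t < 1 -> 0 < P t < 1.
  by move=> /andP[t0 t1]; rewrite -P0 P_lt t0 -P1 P_lt t1.
have psi01' t : 0 < t < 1 -> 0 < psi t < 1.
  by move=> /andP[t0 t1]; rewrite -psi0 psi_lt t0 -psi1 psi_lt t1.
have cs : continuous (fun y => ext g (psi y) : X).
  by move=> y; apply: continuous_comp; [exact: cpsi|exact: ext_continuous].
have [sg sgE] : exists sg : C01 R X, forall t, sg t = ext g (psi (val t)).
  by exists (curve_of cs).
have esgE y : 0 <= y <= 1 -> ext sg y = ext g (psi y).
  by move=> y01; rewrite /ext/= sgE val_clip.
have msg : ae01 (fun t => mderiv sg t = l).
  (* The chain rule gives the speed at the times [P t] for almost every [t]; [ae01_comp], applied to
     [psi], turns this into a statement for almost every new time. *)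
  have H : ae01 (fun t => mderiv sg (P t) = l).
    apply: ae01_imp (ae01I cvP (ae01I g0 (ae01P cvm))) => t t01 [ct [gt0 cgt]].
    rewrite (@mderiv_reparam R X g P psi (w t) t sg)//; last by rewrite divr_gt0.
      by rewrite /w invf_div mulrCA divff ?mulr1// gt_eqF.
    exact: P01'.
  have : ae01 (fun t => mderiv sg (P (psi t)) = l).
    apply: (@ae01_comp _ psi (cst 1) (fun t => mderiv sg (P t) = l)) => //.
    - by apply: (@ae01P R); exists set0; split=> // t /=; apply: contra_notP => _; exact: ltr01.
    - move=> N mN N0; under eq_integral do rewrite mule1.
      rewrite (subst (fun t => (\1_N t)%:E)).
      + have mN' : measurable_fun setT (fun t : R => (\1_N t)%:E : \bar R).
          by apply/measurable_EFinP; exact: measurable_indic.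
        rewrite (@ae_eq_integral _ _ R mu _ (cst 0%E))//; first exact: integral0.
          apply: measurable_funTS; apply: emeasurable_funM => //.
          by apply/measurable_EFinP; exact: measurable_funM.
        exists N; split=> // t /= /not_implyP[_]; apply: contra_notP => nN.
        by rewrite indicE memNset// mul0e.
      + by apply/measurable_EFinP; exact: measurable_indic.
      + by move=> x; rewrite lee_fin.
  by apply: ae01_imp => t _; rewrite pP.
have asg : abs_cont sg.
  exists (cst l).
    apply: continuous_compact_integrable; first exact: segment_compact.
    by apply: continuous_subspaceT => x; exact: cst_continuous.
  move=> s t st; rewrite (integral_itv_cst l st) !sgE.
  have /andP[s0 s1] := I01_itv s; have /andP[t0 t1] := I01_itv t.
  have pst : psi (val s) <= psi (val t) by rewrite psi_le.
  have /andP[ps0 _] := psi01 _ (I01_itv s); have /andP[_ pt1] := psi01 _ (I01_itv t).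
  have := dm _ _ pst; rewrite -lee_fin => /le_trans; apply.
  by rewrite EFin_primB// -wE// -PE// !pP EFinM.
have lsg : curve_length sg = l%:E.
  rewrite /curve_length (@ae_eq_integral _ _ R mu _ (cst l%:E))//.
  - by rewrite integral_cst// [X in (_ * X)%E]muI mule1.
  - by apply: measurable_funTS; apply/measurable_EFinP; exact: measurable_mderiv.
  - by apply: negligibleS (ae01_I01 msg) => t /=; apply: contra_not => H tI; rewrite H.
have mwV : measurable_fun setT (fun t => (w t)^-1).
  rewrite (_ : (fun t => _) = fun t => w t `^ (-1)).
    by apply: (measurableT_comp (measurable_powR (-1))); exact: measurable_funM.
  by apply/funext => t; rewrite powR_inv1.
have mv : measurable_fun setT (fun y => (w (psi y))^-1).
  by apply: (measurableT_comp mwV); exact: continuous_measurable_fun.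
(* By substitution the weight [w] cancels its inverse, and the length of [psi a, psi b] remains.
   Where [w] vanishes the inverse is 0 by convention, but only on a null set. *)
have vE a b : 0 <= a -> a <= b -> b <= 1 ->
    (\int[mu]_(y in `[a, b]) ((w (psi y))^-1)%:E = (psi b - psi a)%:E)%E.
  move=> a0 ab b1.
  pose H x := (\1_(`[a, b]) (P x) * (w x)^-1)%:E : \bar R.
  have mH : measurable_fun setT H.
    apply/measurable_EFinP; apply: measurable_funM => //.
    apply: (measurableT_comp (f := \1_(`[a, b]) : R -> R)).
      by apply: measurable_indic; exact: measurable_itv.
    exact: continuous_measurable_fun.
  have H0 x : (0 <= H x)%E by rewrite lee_fin mulr_ge0// invr_ge0.
  have sub c : c \in `[a, b]%classic -> c \in I01 R.
    by rewrite !inE /I01/= !in_itv/= => /andP[/(le_trans a0) -> /le_trans -> //].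
  transitivity (\int[mu]_(y in I01 R) H (psi y))%E.
    rewrite [LHS]integral_mkcond [RHS]integral_mkcond; apply: eq_integral => y _.
    rewrite !patchE /H pP indicE; have [/[dup] yab /sub ->|yab] := boolP (y \in `[a, b]%classic).
      by rewrite mul1r.
    by rewrite mul0r; case: ifP.
  rewrite subst//.
  have psab : psi a <= psi b by rewrite psi_le.
  rewrite -[psi b - psi a]mul1r -(integral_itv_cst 1 psab).
  have subpsi c : c \in `[psi a, psi b]%classic -> c \in I01 R.
    have /andP[pa0 _] : 0 <= psi a <= 1 by apply: psi01; rewrite a0 (le_trans ab).
    have /andP[_ pb1] : 0 <= psi b <= 1 by apply: psi01; rewrite b1 (le_trans a0).
    by rewrite !inE /I01/= !in_itv/= => /andP[/(le_trans pa0) -> /le_trans -> //].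
  transitivity (\int[mu]_(x in I01 R) (\1_(`[psi a, psi b]) x)%:E)%E.
    apply: ae_eq_integral => //.
    - apply: measurable_funTS; apply: emeasurable_funM => //.
      by apply/measurable_EFinP; exact: measurable_funM.
    - apply: measurable_funTS; apply/measurable_EFinP; apply: measurable_indic.
      exact: measurable_itv.
    - apply: negligibleS (ae01_I01 w_gt0) => x /=; apply: contra_not => wx xI.
      rewrite /H -EFinM mulrVK ?unitfE ?gt_eqF ?wx// !indicE; congr (_%:R%:E).
      have e1 : (psi a <= x) = (a <= P x) by rewrite -{1}(Pp x) psi_le.
      have e2 : (x <= psi b) = (P x <= b) by rewrite -{1}(Pp x) psi_le.
      by apply: congr1; apply/idP/idP; rewrite !inE/= !in_itv/= e1 e2.
  have mpsi : measurable (`[psi a, psi b]%classic : set (measurableTypeR R)).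
    exact: measurable_itv.
  rewrite (integral_cst mu (measurable_itv _) 1%E) mul1e (integral_indic mu mI mpsi).
  by rewrite setIidl// => x xab; have := subpsi x; rewrite !inE; apply.
exists sg; split.
- by split=> //; apply: ae01_imp msg => t _ ->.
- exists (fun t => clip (psi (val t))), (fun t => clip (P (val t))); split.
  + move=> s t st; rewrite !val_clip ?psi_lt//; apply: psi01; exact: I01_itv.
  + split=> t; first by rewrite val_clip ?pP ?clip_val//; apply: psi01; exact: I01_itv.
    by rewrite val_clip ?Pp ?clip_val//; apply: P01; exact: I01_itv.
  + exists (fun y => (w (psi y))^-1).
      apply/integrableP; split.
        by apply: measurable_funTS; apply/measurable_EFinP.
      have := vE 0 1 (lexx _) ler01 (lexx _).
      rewrite -/(I01 R) => vI; rewrite (_ : (\int[mu]_(x in I01 R) _)%E = (psi 1 - psi 0)%:E).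
        exact: ltry.
      by rewrite -vI; apply: eq_integral => y _; rewrite gee0_abs// lee_fin invr_ge0.
    move=> s t st; rewrite !val_clip; try (by apply: psi01; exact: I01_itv).
    have /andP[s0 _] := I01_itv s; have /andP[_ t1] := I01_itv t.
    by rewrite vE// lee_fin /mdist/= ger0_norm// subr_ge0 psi_le.
  + exists w => // s t st; rewrite !val_clip; try (by apply: P01; exact: I01_itv).
    have /andP[s0 _] := I01_itv s; have /andP[_ t1] := I01_itv t.
    by rewrite -PE// lee_fin /mdist/= ger0_norm// subr_ge0 P_le.
  + by move=> t; rewrite sgE.
- by split=> //; [rewrite lsg lte_fin|apply: ae01_imp msg => t _ ->].
Qed.

Lemma jP (c : np_curve X) : np_class c (j c) /\ constant_speed (j c).
Proof.
have [g rg cE] := np_classP c.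
apply: (@getPex _ [set g' | np_class c g' /\ constant_speed g']).
have [sg [rsg rpsg csg]] := constant_speed_reparam rg.
by exists sg; split=> //; rewrite cE.
Qed.

End constant_speed_representative.

(** * Points where [h] is infinite, and the properties of [ft] *)

Section negligibility.
Context {R : realType} {X : completeMetricType R}.
Variables (m : {finite_measure set (borel X) -> \bar R}) (p : R).
Hypothesis p_gt0 : 0 < p.

Lemma negligible_infinite (h : borel X -> \bar R) :
  Lplus p m h -> m.-negligible [set x | h x = +oo%E].
Proof.
move=> [mh h0 hfin].
have mhp : measurable_fun setT (fun x => h x `^ p)%E.
  exact: measurableT_comp (measurable_poweR _) mh.
have ih : m.-integrable setT (fun x => h x `^ p)%E.
  apply/integrableP; split=> //; under eq_integral do rewrite gee0_abs ?poweR_ge0//.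
  exact: hfin.
have := integrable_ae measurableT ih; apply: negligibleS => x /= hx.
by apply/not_implyP; split=> //; rewrite hx poweRyr// gt_eqF.
Qed.

End negligibility.

Unset Implicit Arguments.

Theorem theorem10p3 (R : realType) (X : completeMetricType R)
    (sepX : separable X)
    (m : {finite_measure set (borel X) -> \bar R})
    (p q : R) (p_gt1 : 1 < p) (qE : q = p / (p - 1))
    (f : X -> R) (mf : measurable_fun [set: borel X] (f : borel X -> R))
    (Mod0 : Mod p m [set M g | g in @lipschitz_curve R X `\` Gamma f] = 0%E) :
  exists ft : X -> R,
    [/\ completion_measurable_fun m (ft : borel X -> R),
        m.-negligible [set x | f x <> ft x],
        Mod p m [set M g | g in Gamma f `&` [set g | ~ equals_rep f ft g]] = 0%E,
        q_ae m q (fun g => equals_rep f ft g) &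
        Mod_ae p m (fun c => equals_rep f ft (j c))].
Proof.
have p_gt0 : 0 < p by exact: lt_trans p_gt1.
have [h Lh hbad] := Mod0_infinite p_gt0 Mod0.
have [mh h0 _] := Lh.
have HG g : lipschitz_curve g -> (\int[M g]_x h x < +oo)%E -> Gamma f g.
  move=> Lg hg; apply: contrapT => nG.
  by move: hg; rewrite hbad ?ltxx//; exists g.
pose ft := precise_rep f h.
have Hft g : lipschitz_curve g -> (\int[M g]_x h x < +oo)%E -> equals_rep f ft g.
  exact: precise_repE.
have hinf g : lipschitz_curve g -> ~ equals_rep f ft g -> (\int[M g]_x h x = +oo)%E.
  move=> Lg ng; apply/eqP; rewrite -leye_eq leNgt; apply/negP => hg.
  exact: ng (Hft g Lg hg).
have fft : m.-negligible [set x | f x <> ft x].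
  apply: negligibleS (negligible_infinite p_gt0 Lh) => x /=; apply: contra_notP.
  by move=> /eqP; rewrite -ltey => hx; rewrite /ft precise_rep_fin.
exists ft; split=> //.
(* The preimages of [B] under [f] and [ft] differ only where f and ft differ, so the Borel preimage
   under [f] is the witness for the completion. *)
- move=> B mB; exists (f @^-1` B).
    by rewrite -[_ @^-1` _]setTI; exact: mf.
  apply: negligibleS fft => x /= fx; apply: contrapT => /contrapT E.
  by move: fx; rewrite /= /preimage/= E => -[[]|[]].
- apply: (Mod_infinite p_gt0 Lh) => _ [g [[Lg _] ng] <-]; exact: hinf.
- have H := q_ae_equals_rep p_gt1 qE Lh Hft; exact: H.
- apply: (Mod_infinite p_gt0 Lh) => _ [c nc <-]; have [_ cj] := jP c.
  by apply: integral_J_infinite => //; exact: hinf (constant_speed_lipschitz cj) nc.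
Qed.
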